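(* Let $(C_k)_{k\in\mathbb N_0}$, $(c_k)_{k\in\mathbb N_0}$ be sequences of positive constants. There exists a constant $\overline C>0$, depending only on the constants $C_k,c_k$, such that the following holds. Let $\mu\in C^\infty(\mathbb R^3)$ be a radially symmetric probability density satisfying $|\nabla^k\mu(v)|\le C_ke^{-c_k|v|}$ for all $v\in\mathbb R^3$, $k\in\mathbb N_0$. If $$\mu(v)>0\quad\text{for all }|v|\le\overline C,$$ then $\mu$ satisfies the Penrose stability criterion: there exists $\kappa>0$ such that $$\inf_{\Im(z)\le0,\ \xi\in\mathbb R^3}|1-\hat\phi(\xi)a(z)|\ge\kappa .$$
   Context: $\phi$ is the screened Coulomb potential on $\mathbb R^3$, i.e. $\hat\phi(\xi)=\frac1{1+|\xi|^2}$, with the convention $\hat g(\xi)=\int_{\mathbb R^3}e^{-ix\cdot\xi}g(x)\,dx$. For $z\in\mathbb C$ with $\Im(z)\le0$, $$a(z)=-\int_0^\infty e^{-ipz}\,p\,\hat\mu(pe_1)\,dp,$$ where $e_1$ is the first coordinate vector. *)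

(* Defs.v *)
From HB Require Import structures.
From mathcomp Require Import all_boot all_order all_algebra.
From mathcomp Require Import all_classical all_reals all_analysis.
From mathcomp Require Import complex.

Set Implicit Arguments.
Unset Strict Implicit.
Unset Printing Implicit Defensive.

Import Order.TTheory GRing.Theory Num.Theory.
Import numFieldNormedType.Exports.

Local Open Scope classical_set_scope.
Local Open Scope ring_scope.

Section Euclidean_space.
Context {R : realType}.
Implicit Types v w : 'rV[R]_3.

Definition dot3 v w : R := \sum_(i < 3) v 0 i * w 0 i.

(* The library norm `|v| on row vectors is the sup norm. *)
Definition norm3 v : R := Num.sqrt (dot3 v v).

Definition basis3 (i : 'I_3) : 'rV[R]_3 := delta_mx 0 i.

(* partials [:: i1; ...; ik] f is d_i1 (... (d_ik f)). *)
Definition partials (s : seq 'I_3) (f : 'rV[R]_3 -> R) : 'rV[R]_3 -> R :=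
  foldr (fun i g => fun v => 'D_(basis3 i) g v) f s.

(* All partial derivatives of all orders exist and are continuous. *)
Definition smooth3 (f : 'rV[R]_3 -> R) : Prop :=
  forall s : seq 'I_3, continuous (partials s f) /\
    forall (i : 'I_3) v, derivable (partials s f) v (basis3 i).

(* Euclidean (Frobenius) norm of the k-tensor of k-th order partial
   derivatives. *)
Definition norm_grad (k : nat) (f : 'rV[R]_3 -> R) v : R :=
  Num.sqrt (\sum_(s : k.-tuple 'I_3) (partials s f v) ^+ 2).

Definition radial (f : 'rV[R]_3 -> R) : Prop :=
  forall v w, norm3 v = norm3 w -> f v = f w.

(* R^3 carries Lebesgue measure as the iterated product R * R * R; row vectors
   have no measurable structure in the library. *)
Definition vec3 (x : R * R * R) : 'rV[R]_3 :=
  \row_(i < 3) [:: x.1.1; x.1.2; x.2]`_i.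

Definition lebesgue3 : {measure set
    (measurableTypeR R * measurableTypeR R * measurableTypeR R)%type -> \bar R} :=
  (@lebesgue_measure R \x @lebesgue_measure R \x @lebesgue_measure R)%E.

Definition probability_density3 (f : 'rV[R]_3 -> R) : Prop :=
  (forall v, 0 <= f v) /\ (\int[lebesgue3]_x (f (vec3 x))%:E = 1)%E.

End Euclidean_space.

Section Penrose.
Context {R : realType}.
Local Open Scope complex_scope.

Definition cexp (z : R[i]) : R[i] :=
  (expR (complex.Re z) * cos (complex.Im z)) +i*
  (expR (complex.Re z) * sin (complex.Im z)).

(* Lebesgue integral of a complex-valued function, by real and imaginary
   parts. *)
Definition Cintegral d (T : measurableType d) (m : {measure set T -> \bar R})
    (D : set T) (f : T -> R[i]) : R[i] :=
  (\int[m]_(x in D) complex.Re (f x)) +i* (\int[m]_(x in D) complex.Im (f x)).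

Definition fourier3 (g : 'rV[R]_3 -> R) (xi : 'rV[R]_3) : R[i] :=
  Cintegral lebesgue3 setT
    (fun x => cexp (- ('i%C * (dot3 (vec3 x) xi)%:C)) * (g (vec3 x))%:C).

(* The Fourier transform of the screened Coulomb potential. *)
Definition phi_hat (xi : 'rV[R]_3) : R := (1 + norm3 xi ^+ 2)^-1.

Definition penrose_a (mu : 'rV[R]_3 -> R) (z : R[i]) : R[i] :=
  - Cintegral lebesgue_measure `[0, +oo[
      (fun p : R => cexp (- ('i%C * p%:C * z)) * p%:C *
                    fourier3 mu (p *: basis3 0)).

(* complex.Re / Im / normc are R-valued. *)
Definition penrose_stable (mu : 'rV[R]_3 -> R) : Prop :=
  exists2 kappa : R, 0 < kappa &
    kappa <= inf [set Normc.normc (1 - (phi_hat xi)%:C * penrose_a mu z) |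
                   z in [set z : R[i] | complex.Im z <= 0] &
                   xi in [set: 'rV[R]_3]].

End Penrose.

(* Main.v *)
(* Write f for the radial profile of mu.  Since the marginal of mu along an axis
   has derivative - 2 pi u f(|u|), one gets
     p mu^(p e1) = g(p) := int_0^oo sin(p u) b(u) du,   b(u) = 4 pi u f(u),
   and with z = x - i y, y >= 0,
     Re a(z) = - int_0^oo exp(- p y) cos(p x) g(p) dp,
     Im a(z) = int_0^oo exp(- p y) sin(p x) g(p) dp.
   Integrating by parts bounds g, g' and p g by a multiple of 1 / (1 + p^2),
   with constants depending only on C_k and c_k; hence a is Lipschitz on the
   closed half-plane and |z| |a(z)| is bounded, which fixes Cbar such that
   |a| <= 1/2 outside a square of side Cbar.  For y > 0 Fubini gives
     Im a(z) = int_0^oo b(u) (y / (y^2 + (u - x)^2) - y / (y^2 + (u + x)^2)) / 2 du,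
     Re a(- i y) = - int_0^oo b(u) u / (y^2 + u^2) du,
   so that Im a(z) > 0 for x > 0 while a(- i y) <= 0; this survives on the real
   line at every x > 0 with f(x) > 0, because the first kernel concentrates
   at u = x.  Thus 1 - t a(z) never vanishes on the compact set
   [0, Cbar]^2 x [0, 1], and negative x follow by symmetry. *)

Require Import Defs.
From HB Require Import structures.
From mathcomp Require Import all_boot all_order all_algebra.
From mathcomp Require Import all_classical all_reals all_analysis.
From mathcomp Require Import measurable_realfun lebesgue_integral_under.
From mathcomp Require Import complex.
From mathcomp Require Import ring lra.
Import Order.TTheory GRing.Theory Num.Theory.
Import numFieldNormedType.Exports.
Local Open Scope classical_set_scope.
Local Open Scope ring_scope.
Set Implicit Arguments.
Unset Strict Implicit.
Unset Printing Implicit Defensive.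

(** * Derivatives of real functions *)

Section derivatives.
Context {R : realType}.
Implicit Types (f g : R -> R) (x a : R).

(** The dependence of the constants shapes the argument. [Cbar] may depend on the decay constants
    only, so every estimate is quantitative and carries a single factor in front of the Cauchy
    density 1 / (1 + u^2). [kappa] may depend on mu, so positivity of mu enters only qualitatively,
    through compactness. On the real axis exp(- p y) gives no decay, so g, g' and p g must
    themselves be integrable. Each costs two integrations by parts; for p g this uses the third
    derivative of f, and the last boundary term vanishes because f is even, so f'(0) = 0. Fubini in
    turn needs y > 0, and the kernel becomes singular as y tends to 0. Instead of a Plemelj formula,
    a lower bound at small height that does not degenerate with y is carried to y = 0 by the
    Lipschitz estimate. The frequency xi enters only through the real number t = phi^(xi) in (0, 1];
    admitting t = 0 makes the set of parameters compact. *)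

Lemma is_derive_continuous f df : (forall x, is_derive x 1 f (df x)) ->
  continuous f.
Proof.
by move=> fdf x; apply/differentiable_continuous/derivable1_diffP; case: (fdf x).
Qed.

Lemma is_derive_mul f g x df dg : is_derive x 1 f df -> is_derive x 1 g dg ->
  is_derive x 1 (fun y => f y * g y) (df * g x + f x * dg).
Proof.
move=> Hf Hg; have H := is_deriveM Hf Hg.
by apply: (is_derive_eq H); rewrite /GRing.scale/= addrC [g x * df]mulrC.
Qed.

Lemma is_derive_add f g x df dg : is_derive x 1 f df -> is_derive x 1 g dg ->
  is_derive x 1 (fun y => f y + g y) (df + dg).
Proof. by move=> Hf Hg; exact: is_deriveD. Qed.

Lemma is_derive_opp f x df : is_derive x 1 f df ->
  is_derive x 1 (fun y => - f y) (- df).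
Proof. by move=> Hf; exact: is_deriveN. Qed.

Lemma is_derive_mull f x a df : is_derive x 1 f df ->
  is_derive x 1 (fun y => a * f y) (a * df).
Proof.
move=> Hf; have H := is_derive_mul (is_derive_cst a x 1) Hf.
by apply: (is_derive_eq H); rewrite mul0r add0r.
Qed.

Lemma is_derive_linl a x : is_derive x 1 (fun y => a * y) a.
Proof.
have H := is_derive_mull a (is_derive_id x 1).
by apply: (is_derive_eq H); rewrite mulr1.
Qed.

Lemma is_derive_linr a x : is_derive x 1 (fun y => y * a) a.
Proof.
rewrite (_ : (fun y => y * a) = (fun y => a * y)); first exact: is_derive_linl.
by apply/funext => y; rewrite mulrC.
Qed.

Lemma is_derive_comp f g x df dg : is_derive (g x) 1 f df ->
  is_derive x 1 g dg -> is_derive x 1 (fun y => f (g y)) (df * dg).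
Proof. by move=> Hf Hg; exact: is_derive1_comp. Qed.

(** The derivative need only be bounded to the right of both points, so that exp(- u), whose
    derivative is unbounded on the left, is covered on nonnegative arguments. *)
Lemma lipschitz_of_derive f df (K a b : R) :
  (forall x, is_derive x 1 f (df x)) ->
  (forall x, Num.min a b <= x -> `|df x| <= K) -> `|f a - f b| <= K * `|a - b|.
Proof.
move=> fdf; wlog ab : a b / a <= b => [wl|] dfK.
  have [/wl/(_ dfK)//|/ltW ba] := leP a b.
  rewrite distrC (distrC a); apply: wl => // x; rewrite minC; exact: dfK.
have [|c cab] := @MVT_segment _ f df a b ab (fun x _ => fdf x).
  exact/continuous_subspaceT/(is_derive_continuous fdf).
rewrite distrC => ->; rewrite normrM (distrC a) ler_wpM2r// dfK//.
by rewrite min_l//; move: cab; rewrite in_itv => /andP[].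
Qed.

End derivatives.

(** * Integrals on the half-line dominated by the Cauchy density *)

Section half_line.
Context {R : realType}.
Notation mu := (@lebesgue_measure R).
Notation halfline := (`[0%R, +oo[%classic : set R).
Implicit Types (f g h k : R -> R) (M N a b u p x y : R).

Lemma oneDsqr_gt0 (u : R) : 0 < oneDsqr u.
Proof. exact: lt_le_trans (oneDsqr_ge1 u). Qed.

Lemma measurable_oneDsqrV (D : set R) :
  measurable_fun D (fun u : R => (oneDsqr u)^-1).
Proof.
by apply: measurable_funTS; apply: continuous_measurable_fun;
  exact: continuous_oneDsqrV.
Qed.

Lemma integrable_oneDsqrV :
  mu.-integrable halfline (EFin \o (fun u : R => (oneDsqr u)^-1)).
Proof.
apply/integrableP; split.
  by apply/measurable_EFinP; exact: measurable_oneDsqrV.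
rewrite (_ : (fun x => _) = (fun x : R => (oneDsqr x)^-1%:E)).
  by rewrite integral0y_oneDsqr ltry.
by apply/funext => x /=; rewrite ger0_norm// invr_ge0 ltW// oneDsqr_gt0.
Qed.

(** One fixed comparison function for every integrand: it gives integrability, the bound M * pi / 2
    and vanishing at infinity, so that a single number M records all constants. *)
Definition dominated M h := forall u, 0 <= u -> `|h u| <= M / oneDsqr u.

Lemma integrable_dominated M h : measurable_fun halfline h ->
  dominated M h ->
  mu.-integrable halfline (EFin \o h).
Proof.
move=> mh hM; apply: (le_integrable _ _ _ (integrableZl _ M integrable_oneDsqrV)).
- by [].
- exact/measurable_EFinP.
- move=> u /=; rewrite in_itv/= andbT => u0; rewrite lee_fin.
  by rewrite (le_trans (hM u u0))// ler_norm.
- by [].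
Qed.

Lemma integral_dominated M h : measurable_fun halfline h ->
  dominated M h ->
  `|\int[mu]_(u in halfline) h u| <= M * (pi / 2).
Proof.
move=> mh hM; have ih := integrable_dominated mh hM.
apply: (le_trans (le_normr_Rintegral _ _)) => //.
have <- : \int[mu]_(u in halfline) (M * (oneDsqr u)^-1) = M * (pi / 2).
  by rewrite RintegralZl//; [rewrite /Rintegral integral0y_oneDsqr|
    exact: integrable_oneDsqrV].
apply: le_Rintegral => //.
- exact: integrable_norm.
- exact: (integrableZl _ M integrable_oneDsqrV).
- by move=> u /=; rewrite in_itv/= andbT => /hM.
Qed.

Lemma cvg0_dominated M h : dominated M h ->
  h u @[u --> +oo] --> 0.
Proof.
move=> hM; have M0 : 0 <= M.
  by have := hM 0 (lexx _); rewrite /oneDsqr expr0n/= addr0 divr1;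
    exact: le_trans.
apply/cvgrPdist_le => e e0; near=> u.
have u0 : 0 <= u by near: u; exact: nbhs_pinfty_ge.
have u1 : 1 <= u by near: u; apply: nbhs_pinfty_ge; rewrite num_real.
have uM : M / e <= u by near: u; apply: nbhs_pinfty_ge; rewrite num_real.
rewrite sub0r normrN (le_trans (hM u u0))// ler_pdivrMr ?oneDsqr_gt0//.
rewrite mulrC -ler_pdivrMr// (le_trans uM)// /oneDsqr expr2.
by rewrite ler_wpDl// ler_peMr.
Unshelve. all: by end_near. Qed.

(* Adding a multiple of the arctangent makes the integrand nonnegative, which
   is what the library's improper fundamental theorem asks for. *)
Lemma integral_derive M h k : (forall u : R, is_derive u 1 h (k u)) ->
  continuous k -> dominated M h ->
  dominated M k ->
  \int[mu]_(u in halfline) k u = - h 0.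
Proof.
move=> hk ck hM kM.
have mk : measurable_fun halfline k.
  by apply: measurable_funTS; exact: continuous_measurable_fun.
have iM : mu.-integrable halfline (EFin \o (fun u : R => M * (oneDsqr u)^-1)).
  exact: (integrableZl _ M integrable_oneDsqrV).
pose H u := h u + M * atan u.
pose K u := k u + M * (oneDsqr u)^-1.
have HK (u : R) : is_derive u 1 H (K u).
  by apply: is_derive_add => //; exact/is_derive_mull.
have cK : continuous K.
  move=> u; apply: cvgD; first exact: ck.
  by apply: cvgM; [exact: cvg_cst|exact: continuous_oneDsqrV].
have : \int[mu]_(u in halfline) K u = M * (pi / 2) - H 0.
  apply: Rintegral_ge0_continuous_FTC2y.
  - move=> u /kM; rewrite ler_norml => /andP[+ _].
    by rewrite lerNl -subr_ge0 opprK addrC.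
  - exact: continuous_subspaceT.
  - rewrite -[X in _ --> X]add0r; apply: cvgD; first exact: cvg0_dominated hM.
    by apply: cvgM; [exact: cvg_cst|exact: cvgy_atan].
  - by move=> u _; apply: ex_derive.
  - by apply: cvg_at_right_filter; exact: (is_derive_continuous HK).
  - by move=> u _; rewrite derive1E; apply: derive_val.
rewrite RintegralD//; last exact: integrable_dominated kM.
rewrite RintegralZl//; last exact: integrable_oneDsqrV.
rewrite [X in _ + _ * X](_ : _ = pi / 2); last first.
  by rewrite /Rintegral integral0y_oneDsqr.
by rewrite /H atan0; lra.
Qed.

Lemma dominated_mull M h k : (forall u, 0 <= u -> `|k u| <= 1) ->
  dominated M h -> dominated M (fun u => k u * h u).
Proof.
move=> k1 hM u u0; rewrite normrM (le_trans _ (hM u u0))//.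
by rewrite ler_piMl// k1.
Qed.

Lemma dominatedD M N h k : dominated M h -> dominated N k ->
  dominated (M + N) (fun u => h u + k u).
Proof.
move=> hM kN u u0; rewrite mulrDl (le_trans (ler_normD _ _))//.
by rewrite lerD ?hM ?kN.
Qed.

Lemma dominatedZ M a h : dominated M h ->
  dominated (`|a| * M) (fun u => a * h u).
Proof.
by move=> hM u u0; rewrite normrM -mulrA ler_wpM2l// hM.
Qed.

Lemma dominated_le M N h : M <= N -> dominated M h -> dominated N h.
Proof.
move=> MN hM u u0; rewrite (le_trans (hM u u0))// ler_wpM2r//.
Qed.

Lemma dominated_ge0 M h : dominated M h -> 0 <= M.
Proof.
move=> /(_ 0 (lexx _)); rewrite /oneDsqr expr0n/= addr0 divr1.
exact: le_trans.
Qed.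

Lemma continuous_mul h k : continuous h -> continuous k ->
  continuous (fun u => h u * k u).
Proof. by move=> ch ck u; apply: cvgM; [exact: ch|exact: ck]. Qed.

Lemma continuous_add h k : continuous h -> continuous k ->
  continuous (fun u => h u + k u).
Proof. by move=> ch ck u; apply: cvgD; [exact: ch|exact: ck]. Qed.

Lemma measurable_continuous (D : set R) h : continuous h -> measurable_fun D h.
Proof.
by move=> ch; apply: measurable_funTS; exact: continuous_measurable_fun.
Qed.

Lemma integrableZ_EFin a h : mu.-integrable halfline (EFin \o h) ->
  mu.-integrable halfline (EFin \o (fun u => a * h u)).
Proof. exact: (integrableZl _ a). Qed.

(** Common form of all integrations by parts below: f and g are the two trigonometric products that
    differentiation of the kernel creates, k carries the derivative of the transformed function, and
    - h 0 is the boundary term. *)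
Lemma integral_derive_lin M a b h f g k :
  (forall u : R, is_derive u 1 h (a * f u + b * g u + k u)) ->
  continuous f -> continuous g -> continuous k ->
  dominated M h -> dominated M f -> dominated M g -> dominated M k ->
  a * \int[mu]_(u in halfline) f u + b * \int[mu]_(u in halfline) g u
    + \int[mu]_(u in halfline) k u = - h 0.
Proof.
move=> hd cf cg ck hM fM gM kM.
have if_ : mu.-integrable halfline (EFin \o f).
  by apply: integrable_dominated fM; exact: measurable_continuous.
have ig : mu.-integrable halfline (EFin \o g).
  by apply: integrable_dominated gM; exact: measurable_continuous.
have ik : mu.-integrable halfline (EFin \o k).
  by apply: integrable_dominated kM; exact: measurable_continuous.
have iaf := integrableZ_EFin a if_; have ibg := integrableZ_EFin b ig.
rewrite -!RintegralZl// -!RintegralD//; last first.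
  exact: (integrableD _ iaf ibg).
have M0 := dominated_ge0 hM.
apply: (@integral_derive (`|a| * M + `|b| * M + M) _ _ hd).
- apply: continuous_add => //; apply: continuous_add;
    by apply: continuous_mul => //; exact: cst_continuous.
- by apply: dominated_le hM; rewrite lerDr addr_ge0// mulr_ge0.
- by apply: dominatedD => //; apply: dominatedD; exact: dominatedZ.
Qed.

End half_line.

(** * Sine and cosine transforms *)

Section trigonometric_transforms.
Context {R : realType}.
Notation mu := (@lebesgue_measure R).
Notation halfline := (`[0%R, +oo[%classic : set R).
Implicit Types (h k : R -> R) (M u p x y : R).

Definition sinT h p := \int[mu]_(u in halfline) (sin (p * u) * h u).
Definition cosT h p := \int[mu]_(u in halfline) (cos (p * u) * h u).

Lemma abs_sin_le1 x : `|sin x| <= 1.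
Proof. by rewrite ler_norml sin_geN1 sin_le1. Qed.

Lemma abs_cos_le1 x : `|cos x| <= 1.
Proof. by rewrite ler_norml cos_geN1 cos_le1. Qed.

Lemma is_derive_sin_lin p u : is_derive u 1 (fun v => sin (p * v))
  (p * cos (p * u)).
Proof.
have H := is_derive_comp (is_derive_sin (p * u)) (is_derive_linl p u).
by apply: (is_derive_eq H); rewrite mulrC.
Qed.

Lemma is_derive_cos_lin p u : is_derive u 1 (fun v => cos (p * v))
  (- (p * sin (p * u))).
Proof.
have H := is_derive_comp (is_derive_cos (p * u)) (is_derive_linl p u).
by apply: (is_derive_eq H); rewrite mulrC mulrN.
Qed.

Lemma continuous_sin_lin p : continuous (fun u => sin (p * u)).
Proof. exact: is_derive_continuous (is_derive_sin_lin p). Qed.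

Lemma continuous_cos_lin p : continuous (fun u => cos (p * u)).
Proof. exact: is_derive_continuous (is_derive_cos_lin p). Qed.

Lemma dominated_sin M h p : dominated M h ->
  dominated M (fun u => sin (p * u) * h u).
Proof. by apply: dominated_mull => u _; exact: abs_sin_le1. Qed.

Lemma dominated_cos M h p : dominated M h ->
  dominated M (fun u => cos (p * u) * h u).
Proof. by apply: dominated_mull => u _; exact: abs_cos_le1. Qed.

Lemma sinT_le M h p : continuous h -> dominated M h ->
  `|sinT h p| <= M * (pi / 2).
Proof.
move=> ch hM; apply: integral_dominated; last exact: dominated_sin.
by apply: measurable_continuous; apply: continuous_mul => //; exact: continuous_sin_lin.
Qed.

Lemma cosT_le M h p : continuous h -> dominated M h ->
  `|cosT h p| <= M * (pi / 2).
Proof.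
move=> ch hM; apply: integral_dominated; last exact: dominated_cos.
by apply: measurable_continuous; apply: continuous_mul => //; exact: continuous_cos_lin.
Qed.

Lemma integrable_sinT M h p : continuous h -> dominated M h ->
  mu.-integrable halfline (EFin \o (fun u => sin (p * u) * h u)).
Proof.
move=> ch hM; apply: (@integrable_dominated _ M); last exact: dominated_sin.
by apply: measurable_continuous; apply: continuous_mul => //; exact: continuous_sin_lin.
Qed.

Lemma integrable_cosT M h p : continuous h -> dominated M h ->
  mu.-integrable halfline (EFin \o (fun u => cos (p * u) * h u)).
Proof.
move=> ch hM; apply: (@integrable_dominated _ M); last exact: dominated_cos.
by apply: measurable_continuous; apply: continuous_mul => //; exact: continuous_cos_lin.
Qed.

Lemma sinTZ M a h p : continuous h -> dominated M h ->
  sinT (fun u => a * h u) p = a * sinT h p.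
Proof.
move=> ch hM; have i := integrable_sinT p ch hM.
rewrite -(RintegralZl a _ i)//.
by apply: eq_Rintegral => u _; rewrite mulrCA.
Qed.

Lemma cosTZ M a h p : continuous h -> dominated M h ->
  cosT (fun u => a * h u) p = a * cosT h p.
Proof.
move=> ch hM; have i := integrable_cosT p ch hM.
rewrite -(RintegralZl a _ i)//.
by apply: eq_Rintegral => u _; rewrite mulrCA.
Qed.

Lemma cosT_derive M h k p : (forall u, is_derive u 1 h (k u)) -> continuous k ->
  dominated M h -> dominated M k -> p * cosT h p = - sinT k p.
Proof.
move=> hk ck hM kM; have ch := is_derive_continuous hk.
have cE h' : continuous h' -> continuous (fun u => cos (p * u) * h' u).
  by apply: continuous_mul; exact: continuous_cos_lin.
have sE h' : continuous h' -> continuous (fun u => sin (p * u) * h' u).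
  by apply: continuous_mul; exact: continuous_sin_lin.
(* Without an exponential factor only one trigonometric product appears; the zero term fills the
   second slot of [integral_derive_lin]. *)
have H u : is_derive u 1 (fun u => sin (p * u) * h u) (p * (cos (p * u) * h u)
    + 0 * (cos (p * u) * h u) + sin (p * u) * k u).
  apply: (is_derive_eq (is_derive_mul (is_derive_sin_lin p u) (hk u))); ring.
have := integral_derive_lin H (cE _ ch) (cE _ ch) (sE _ ck)
  (dominated_sin p hM) (dominated_cos p hM) (dominated_cos p hM)
  (dominated_sin p kM).
by rewrite mulr0 sin0 !mul0r oppr0 addr0 => /eqP; rewrite addr_eq0 => /eqP.
Qed.

Lemma sinT_derive M h k p : (forall u, is_derive u 1 h (k u)) -> continuous k ->
  dominated M h -> dominated M k -> p * sinT h p = cosT k p + h 0.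
Proof.
move=> hk ck hM kM; have ch := is_derive_continuous hk.
have cE h' : continuous h' -> continuous (fun u => cos (p * u) * h' u).
  by apply: continuous_mul; exact: continuous_cos_lin.
have sE h' : continuous h' -> continuous (fun u => sin (p * u) * h' u).
  by apply: continuous_mul; exact: continuous_sin_lin.
have H u : is_derive u 1 (fun u => cos (p * u) * h u) (- p * (sin (p * u) * h u)
    + 0 * (sin (p * u) * h u) + cos (p * u) * k u).
  apply: (is_derive_eq (is_derive_mul (is_derive_cos_lin p u) (hk u))); ring.
have := integral_derive_lin H (sE _ ch) (sE _ ch) (cE _ ck)
  (dominated_cos p hM) (dominated_sin p hM) (dominated_sin p hM)
  (dominated_cos p kM).
by rewrite mulr0 cos0 mul1r -/(sinT h p) -/(cosT k p); lra.
Qed.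

Lemma le_oneDsqrV (K a p : R) : `|a| <= K -> `|p ^+ 2 * a| <= K ->
  `|a| <= (K + K) / oneDsqr p.
Proof.
move=> aK paK; rewrite ler_pdivlMr ?oneDsqr_gt0// -[oneDsqr p]ger0_norm; last first.
  by rewrite ltW// oneDsqr_gt0.
rewrite -normrM /oneDsqr mulrDr mulr1 (le_trans (ler_normD _ _))//.
by rewrite lerD// mulrC.
Qed.

(** Two integrations by parts bound p^2 times the transform. The sine kills the boundary term of one
    of them; h 0 = 0 kills the other. *)
Lemma sinT_decay M h h1 h2 p : (forall u, is_derive u 1 h (h1 u)) ->
  (forall u, is_derive u 1 h1 (h2 u)) -> continuous h2 -> dominated M h ->
  dominated M h1 -> dominated M h2 -> h 0 = 0 ->
  `|sinT h p| <= (M * pi) / oneDsqr p.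
Proof.
move=> hh1 hh2 ch2 hM h1M h2M h0; have ch1 := is_derive_continuous hh2.
rewrite [M * pi](_ : _ = M * (pi / 2) + M * (pi / 2)); last by field.
apply: le_oneDsqrV; first exact: sinT_le (is_derive_continuous hh1) hM.
rewrite expr2 -mulrA (sinT_derive p hh1 ch1 hM h1M) h0 addr0.
by rewrite (cosT_derive p hh2 ch2 h1M h2M) normrN; exact: sinT_le.
Qed.

(** Here the sine kills the boundary term of the first integration by parts, so the condition falls
    on h1 instead of h. *)
Lemma cosT_decay M h h1 h2 p : (forall u, is_derive u 1 h (h1 u)) ->
  (forall u, is_derive u 1 h1 (h2 u)) -> continuous h2 -> dominated M h ->
  dominated M h1 -> dominated M h2 -> h1 0 = 0 ->
  `|cosT h p| <= (M * pi) / oneDsqr p.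
Proof.
move=> hh1 hh2 ch2 hM h1M h2M h10; have ch1 := is_derive_continuous hh2.
rewrite [M * pi](_ : _ = M * (pi / 2) + M * (pi / 2)); last by field.
apply: le_oneDsqrV; first exact: cosT_le (is_derive_continuous hh1) hM.
rewrite expr2 -mulrA (cosT_derive p hh1 ch1 hM h1M) mulrN normrN.
by rewrite (sinT_derive p hh2 ch2 h1M h2M) h10 addr0; exact: cosT_le.
Qed.

Lemma continuous_cosT M h : continuous h -> dominated M h ->
  continuous (cosT h).
Proof.
move=> ch hM p.
have Ip : p \in (`]p - 1, p + 1[%classic : set R).
  by rewrite inE/= in_itv/= ltrBlDr ltrDl ltr01.
have D : forall x, x \in `]p - 1, p + 1[ ->
  mu.-integrable halfline (EFin \o (fun u => cos (x * u) * h u)).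
  by move=> x _; exact: integrable_cosT hM.
apply: (@continuity_under_integral R _ _ mu (fun x u => cos (x * u) * h u)
  halfline _ (p - 1) (p + 1) _ _ (fun u => M / oneDsqr u)) => //.
- apply: aeW => u _ x _.
  apply: cvgM; last exact: cvg_cst.
  apply: (@continuous_comp _ _ _ (fun x => x * u) cos).
    by apply: cvgM; [exact: cvg_id|exact: cvg_cst].
  exact: continuous_cos.
- exact: (integrableZl _ M integrable_oneDsqrV).
- move=> x _; apply: aeW => u /=; rewrite in_itv/= andbT => u0.
  exact: dominated_cos.
Qed.

Lemma is_derive_sinT M h p : continuous h -> dominated M h ->
  dominated M (fun u => u * h u) ->
  is_derive p 1 (sinT h) (cosT (fun u => u * h u) p).
Proof.
move=> ch hM uhM.
have dE x u : is_derive x 1 (fun x => sin (x * u) * h u)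
    (cos (x * u) * (u * h u)).
  have H1 := is_derive_comp (g := fun x => x * u) (is_derive_sin (x * u))
    (is_derive_linr u x).
  have H := is_derive_mul H1 (is_derive_cst (h u) x 1).
  by apply: (is_derive_eq H); rewrite mulr0 addr0 mulrA.
pose f (x u : R) := sin (x * u) * h u.
have d1 x u : partial1of2 f x u = cos (x * u) * (u * h u).
  by rewrite partial1of2E /f; exact: derive_val.
have Ip : `](p - 1), (p + 1)[%classic p.
  by rewrite /= in_itv/= ltrBlDr ltrDl ltr01.
have intf x : `](p - 1), (p + 1)[%classic x ->
    mu.-integrable halfline (EFin \o f x).
  by move=> _; exact: integrable_sinT hM.
have df x u : `](p - 1), (p + 1)[%classic x -> halfline u ->
    derivable (f ^~ u) x 1.
  by move=> _ _; apply: ex_derive.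
have M0 := dominated_ge0 hM.
have G0 u : 0 <= M / oneDsqr u by rewrite divr_ge0// ltW// oneDsqr_gt0.
have iG : mu.-integrable halfline (EFin \o (fun u => M / oneDsqr u)).
  exact: (integrableZl _ M integrable_oneDsqrV).
have Gub x u : `](p - 1), (p + 1)[%classic x -> halfline u ->
    `|partial1of2 f x u| <= M / oneDsqr u.
  move=> _ /=; rewrite in_itv/= andbT d1 => u0; exact: dominated_cos uhM _ u0.
have mH : measurable halfline by [].
have E : \int[mu]_(u in halfline) partial1of2 f p u = cosT (fun u => u * h u) p.
  by apply: eq_Rintegral => u _; rewrite d1.
apply: DeriveDef.
  exact: (@derivable_under_integral R _ _ mu f halfline mH p (p - 1) (p + 1) Ip intf df _ G0 iG Gub).
rewrite -derive1E -E.
exact: (@differentiation_under_integral R _ _ mu f halfline mH p (p - 1) (p + 1) Ip intf df _ G0 iG Gub).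
Qed.

End trigonometric_transforms.

(** * Laplace transforms with a trigonometric factor *)

Section laplace_transforms.
Context {R : realType}.
Notation mu := (@lebesgue_measure R).
Notation halfline := (`[0%R, +oo[%classic : set R).
Implicit Types (g h k : R -> R) (M K a b c e u p x y z w : R).

(** [lapC] and - [lapS] are the real and imaginary parts of the integral of exp(- i p z) g(p) at z =
    x - i y. *)
Definition lapC g x y :=
  \int[mu]_(p in halfline) (expR (- (p * y)) * cos (p * x) * g p).
Definition lapS g x y :=
  \int[mu]_(p in halfline) (expR (- (p * y)) * sin (p * x) * g p).

Lemma is_derive_expN y p :
  is_derive p 1 (fun p => expR (- (p * y))) (- y * expR (- (p * y))).
Proof.
have H := is_derive_comp (g := fun p => - (p * y)) (is_derive_expR (- (p * y)))
  (is_derive_opp (is_derive_linr y p)).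
by apply: (is_derive_eq H); rewrite mulrC.
Qed.

Lemma is_derive_expN_sin x y p :
  is_derive p 1 (fun p => expR (- (p * y)) * sin (p * x))
   (- y * (expR (- (p * y)) * sin (p * x)) + x * (expR (- (p * y)) * cos (p * x))).
Proof.
have H := is_derive_mul (is_derive_expN y p) (is_derive_comp
  (g := fun p => p * x) (is_derive_sin (p * x)) (is_derive_linr x p)).
by apply: (is_derive_eq H); ring.
Qed.

Lemma is_derive_expN_cos x y p :
  is_derive p 1 (fun p => expR (- (p * y)) * cos (p * x))
   (- y * (expR (- (p * y)) * cos (p * x)) - x * (expR (- (p * y)) * sin (p * x))).
Proof.
have H := is_derive_mul (is_derive_expN y p) (is_derive_comp
  (g := fun p => p * x) (is_derive_cos (p * x)) (is_derive_linr x p)).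
by apply: (is_derive_eq H); ring.
Qed.

Lemma continuous_expN_cos x y : continuous (fun p => expR (- (p * y)) * cos (p * x)).
Proof. exact: is_derive_continuous (is_derive_expN_cos x y). Qed.

Lemma continuous_expN_sin x y : continuous (fun p => expR (- (p * y)) * sin (p * x)).
Proof. exact: is_derive_continuous (is_derive_expN_sin x y). Qed.

Lemma expN_cos_le1 x y p : 0 <= y -> 0 <= p ->
  `|expR (- (p * y)) * cos (p * x)| <= 1.
Proof.
move=> y0 p0; rewrite normrM (ger0_norm (expR_ge0 _)) mulr_ile1 ?expR_ge0//.
  by rewrite -[leRHS]expR0 ler_expR oppr_le0 mulr_ge0.
exact: abs_cos_le1.
Qed.

Lemma expN_sin_le1 x y p : 0 <= y -> 0 <= p ->
  `|expR (- (p * y)) * sin (p * x)| <= 1.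
Proof.
move=> y0 p0; rewrite normrM (ger0_norm (expR_ge0 _)) mulr_ile1 ?expR_ge0//.
  by rewrite -[leRHS]expR0 ler_expR oppr_le0 mulr_ge0.
exact: abs_sin_le1.
Qed.

Lemma dominated_expN_cos M g x y : 0 <= y -> dominated M g ->
  dominated M (fun p => expR (- (p * y)) * cos (p * x) * g p).
Proof. by move=> y0; apply: dominated_mull => p p0; exact: expN_cos_le1. Qed.

Lemma dominated_expN_sin M g x y : 0 <= y -> dominated M g ->
  dominated M (fun p => expR (- (p * y)) * sin (p * x) * g p).
Proof. by move=> y0; apply: dominated_mull => p p0; exact: expN_sin_le1. Qed.

Lemma measurable_lapC (D : set R) g x y : continuous g ->
  measurable_fun D (fun p => expR (- (p * y)) * cos (p * x) * g p).
Proof.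
by move=> cg; apply: measurable_continuous; apply: continuous_mul => //;
  exact: continuous_expN_cos.
Qed.

Lemma measurable_lapS (D : set R) g x y : continuous g ->
  measurable_fun D (fun p => expR (- (p * y)) * sin (p * x) * g p).
Proof.
by move=> cg; apply: measurable_continuous; apply: continuous_mul => //;
  exact: continuous_expN_sin.
Qed.

Lemma integrable_lapS M g x y : 0 <= y -> continuous g -> dominated M g ->
  mu.-integrable halfline (EFin \o (fun p => expR (- (p * y)) * sin (p * x) * g p)).
Proof.
move=> y0 cg gM; apply: (integrable_dominated (M := M)).
  exact: measurable_lapS.
exact: dominated_expN_sin.
Qed.

Lemma lapC_le M g x y : 0 <= y -> continuous g -> dominated M g ->
  `|lapC g x y| <= M * (pi / 2).
Proof.
move=> y0 cg gM; apply: integral_dominated; first exact: measurable_lapC.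
exact: dominated_expN_cos.
Qed.

Lemma lapS_le M g x y : 0 <= y -> continuous g -> dominated M g ->
  `|lapS g x y| <= M * (pi / 2).
Proof.
move=> y0 cg gM; apply: integral_dominated; first exact: measurable_lapS.
exact: dominated_expN_sin.
Qed.

(** With G and G1 the transforms of g and g1 at z = x - i y, this and [lapS_derive] are the real and
    imaginary parts of i z G = G1 + g(0). *)
Lemma lapC_derive M g g1 x y : 0 <= y -> (forall p, is_derive p 1 g (g1 p)) ->
  continuous g1 -> dominated M g -> dominated M g1 ->
  y * lapC g x y + x * lapS g x y = lapC g1 x y + g 0.
Proof.
move=> y0 gg1 cg1 gM g1M; have cg := is_derive_continuous gg1.
have H p : is_derive p 1 (fun p => expR (- (p * y)) * cos (p * x) * g p)
    (- y * (expR (- (p * y)) * cos (p * x) * g p)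
     + - x * (expR (- (p * y)) * sin (p * x) * g p)
     + expR (- (p * y)) * cos (p * x) * g1 p).
  by apply: (is_derive_eq (is_derive_mul (is_derive_expN_cos x y p) (gg1 p))); ring.
have cC := @continuous_expN_cos x y; have cS := @continuous_expN_sin x y.
have := integral_derive_lin H (continuous_mul cC cg) (continuous_mul cS cg)
  (continuous_mul cC cg1) (dominated_expN_cos x y0 gM)
  (dominated_expN_cos x y0 gM) (dominated_expN_sin x y0 gM)
  (dominated_expN_cos x y0 g1M).
rewrite !mul0r oppr0 expR0 cos0 !mul1r -/(lapC g x y) -/(lapS g x y).
by rewrite -/(lapC g1 x y); lra.
Qed.

Lemma lapS_derive M g g1 x y : 0 <= y -> (forall p, is_derive p 1 g (g1 p)) ->
  continuous g1 -> dominated M g -> dominated M g1 ->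
  y * lapS g x y - x * lapC g x y = lapS g1 x y.
Proof.
move=> y0 gg1 cg1 gM g1M; have cg := is_derive_continuous gg1.
have H p : is_derive p 1 (fun p => expR (- (p * y)) * sin (p * x) * g p)
    (x * (expR (- (p * y)) * cos (p * x) * g p)
     + - y * (expR (- (p * y)) * sin (p * x) * g p)
     + expR (- (p * y)) * sin (p * x) * g1 p).
  by apply: (is_derive_eq (is_derive_mul (is_derive_expN_sin x y p) (gg1 p))); ring.
have cC := @continuous_expN_cos x y; have cS := @continuous_expN_sin x y.
have := integral_derive_lin H (continuous_mul cC cg) (continuous_mul cS cg)
  (continuous_mul cS cg1) (dominated_expN_sin x y0 gM)
  (dominated_expN_cos x y0 gM) (dominated_expN_sin x y0 gM)
  (dominated_expN_sin x y0 g1M).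
rewrite !mul0r oppr0 expR0 sin0 mulr0 mul0r -/(lapC g x y) -/(lapS g x y).
by rewrite -/(lapS g1 x y); lra.
Qed.

(** Taking squared moduli in i z G = G1, which holds as g(0) = 0, leaves only the uniform bounds on
    the transform of g1. *)
Lemma lap_decay M g g1 x y : 0 <= y -> (forall p, is_derive p 1 g (g1 p)) ->
  continuous g1 -> dominated M g -> dominated M g1 -> g 0 = 0 ->
  (x ^+ 2 + y ^+ 2) * (lapC g x y ^+ 2 + lapS g x y ^+ 2) <= 2 * (M * (pi / 2)) ^+ 2.
Proof.
move=> y0 gg1 cg1 gM g1M g0.
have H1 := lapC_derive x y0 gg1 cg1 gM g1M.
have H2 := lapS_derive x y0 gg1 cg1 gM g1M.
have sq a K : `|a| <= K -> a ^+ 2 <= K ^+ 2.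
  move=> aK; rewrite -(real_normK (num_real a)) ler_sqr// nnegrE//.
  exact: le_trans aK.
rewrite [leLHS](_ : _ = lapC g1 x y ^+ 2 + lapS g1 x y ^+ 2).
  by rewrite mulr_natl mulr2n lerD// sq// ?lapC_le// lapS_le.
by move: H1; rewrite g0 addr0 => <-; rewrite -H2; ring.
Qed.

Lemma expN_lipschitz a b : 0 <= a -> 0 <= b ->
  `|expR (- a) - expR (- b)| <= `|a - b|.
Proof.
move=> a0 b0; rewrite -[leRHS]mul1r.
apply: (@lipschitz_of_derive R (fun a => expR (- a)) (fun a => - expR (- a))).
  move=> u; have H := is_derive_comp (g := fun p => - p) (is_derive_expR (- u))
    (is_derive_opp (is_derive_id u 1)).
  by apply: (is_derive_eq H); rewrite mulrN mulr1.
move=> u mu; rewrite normrN ger0_norm ?expR_ge0// -expR0 ler_expR oppr_le0.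
by apply: le_trans mu; rewrite le_min a0.
Qed.

Lemma cos_lipschitz a b : `|cos a - cos b| <= `|a - b|.
Proof.
rewrite -[leRHS]mul1r; apply: (@lipschitz_of_derive R cos (fun a => - sin a)).
by move=> u _; rewrite normrN abs_sin_le1.
Qed.

Lemma sin_lipschitz a b : `|sin a - sin b| <= `|a - b|.
Proof.
rewrite -[leRHS]mul1r; apply: (@lipschitz_of_derive R sin cos).
by move=> u _; rewrite abs_cos_le1.
Qed.

Lemma mul_lipschitz e e' c c' : 0 <= e' <= 1 -> `|c| <= 1 ->
  `|e * c - e' * c'| <= `|e - e'| + `|c - c'|.
Proof.
move=> /andP[e0 e1] c1.
rewrite (_ : e * c - e' * c' = (e - e') * c + e' * (c - c')); last by ring.
rewrite (le_trans (ler_normD _ _))// lerD// normrM.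
  by rewrite ler_piMr.
by rewrite (ger0_norm e0) ler_piMl.
Qed.

(** Moving z changes the kernel at p by at most p times the displacement, and that factor p is
    absorbed by the domination of p * g p. The estimate therefore reaches y = 0. The function t
    stands for cosine or sine. *)
Lemma lap_lipschitz M g (t : R -> R) x x' y y' : 0 <= y -> 0 <= y' ->
  (forall a b, `|t a - t b| <= `|a - b|) -> (forall a, `|t a| <= 1) ->
  continuous t ->
  continuous g -> dominated M g -> dominated M (fun p => p * g p) ->
  `|\int[mu]_(p in halfline) (expR (- (p * y)) * t (p * x) * g p) -
    \int[mu]_(p in halfline) (expR (- (p * y')) * t (p * x') * g p)|
  <= (`|x - x'| + `|y - y'|) * (M * (pi / 2)).
Proof.
move=> y0 y'0 tlip t1 ct cg gM pgM.
have cT z w : continuous (fun p => expR (- (p * w)) * t (p * z) * g p).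
  apply: continuous_mul => //; apply: continuous_mul.
    exact: is_derive_continuous (is_derive_expN w).
  move=> p; apply: (@continuous_comp _ _ _ (fun p => p * z) t); last exact: ct.
  exact: is_derive_continuous (is_derive_linr z) p.
have e01 w p : 0 <= w -> 0 <= p -> 0 <= expR (- (p * w)) <= 1.
  move=> w0 p0; rewrite expR_ge0 -[leRHS]expR0 ler_expR oppr_le0 mulr_ge0//.
have iT z w : 0 <= w -> mu.-integrable halfline
    (EFin \o (fun p => expR (- (p * w)) * t (p * z) * g p)).
  move=> w0; apply: (integrable_dominated (M := M)).
    exact: measurable_continuous.
  apply: dominated_mull gM => p p0; have /andP[a b] := e01 _ _ w0 p0.
  by rewrite normrM (ger0_norm a) mulr_ile1.
rewrite -RintegralB//; [|exact: iT|exact: iT].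
rewrite [leRHS]mulrA; apply: (@integral_dominated R ((`|x - x'| + `|y - y'|) * M)
  (fun p => expR (- (p * y)) * t (p * x) * g p
    - expR (- (p * y')) * t (p * x') * g p)).
  apply: measurable_continuous => p.
  by apply: cvgB; exact: cT.
move=> p p0; rewrite -mulrBl normrM.
apply: (@le_trans _ _ (p * (`|x - x'| + `|y - y'|) * `|g p|)).
  apply: ler_wpM2r => //; apply: (le_trans (mul_lipschitz _ _ _ _)) => //.
    exact: e01.
  rewrite mulrDr addrC lerD//.
    by rewrite (le_trans (tlip _ _))// -mulrBr normrM ger0_norm.
  rewrite (le_trans (expN_lipschitz _ _)) ?mulr_ge0//.
  by rewrite -mulrBr normrM ger0_norm.
rewrite mulrAC mulrC -mulrA ler_wpM2l ?addr_ge0//.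
by have := pgM p p0; rewrite normrM ger0_norm.
Qed.

Lemma lapC_lipschitz M g x x' y y' : 0 <= y -> 0 <= y' ->
  continuous g -> dominated M g -> dominated M (fun p => p * g p) ->
  `|lapC g x y - lapC g x' y'| <= (`|x - x'| + `|y - y'|) * (M * (pi / 2)).
Proof.
move=> y0 y'0; apply: lap_lipschitz => //; first exact: cos_lipschitz.
  exact: abs_cos_le1.
exact: continuous_cos.
Qed.

Lemma lapS_lipschitz M g x x' y y' : 0 <= y -> 0 <= y' ->
  continuous g -> dominated M g -> dominated M (fun p => p * g p) ->
  `|lapS g x y - lapS g x' y'| <= (`|x - x'| + `|y - y'|) * (M * (pi / 2)).
Proof.
move=> y0 y'0; apply: lap_lipschitz => //; first exact: sin_lipschitz.
  exact: abs_sin_le1.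
exact: continuous_sin.
Qed.

End laplace_transforms.

(** * Exponential bounds and Fubini on the half-line *)

Section fubini_halfline.
Context {R : realType}.
Notation mu := (@lebesgue_measure R).
Notation halfline := (`[0%R, +oo[%classic : set R).
Implicit Types (f g h k : R -> R) (M N K a b c e u p x y z w : R).

Lemma oneDsqr_le_expR n c : 0 < c ->
  exists2 N, 0 < N & forall u, oneDsqr u ^+ n <= N * expR (c * `|u|).
Proof.
move=> c0; wlog -> : n c c0 / n = 1%N.
  (* The n-th power follows from the first one with the rate c / n, raised to the power n. *)
  move=> wl; case: n => [|n].
    exists 1 => // u; rewrite expr0 mul1r -[leLHS]expR0 ler_expR mulr_ge0//.
    exact: ltW.
  have cn : 0 < c / n.+1%:R by rewrite divr_gt0.
  have [N N0 H] := wl 1%N _ cn erefl.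
  exists (N ^+ n.+1) => [|u]; first exact: exprn_gt0.
  rewrite (_ : c * `|u| = (c / n.+1%:R * `|u|) *+ n.+1); last first.
    by rewrite -mulr_natr; field; rewrite (addrC 1) natr1 pnatr_eq0.
  rewrite -mulr_natl expRM_natl -exprMn lerXn2r ?nnegrE//.
    by rewrite mulr_ge0 ?expR_ge0// ltW.
  exact: H.
(* Squaring 1 + w <= exp w at w = c |u| / 2 gives 1 + w^2 <= exp (c |u|); multiplied by 4 / c^2 the
   term w^2 becomes u^2. *)
exists (1 + 4 / c ^+ 2) => [|u].
  by rewrite addr_gt0// divr_gt0// exprn_gt0.
rewrite expr1 /oneDsqr -(real_normK (num_real u)); set v := `|u|.
have v0 : 0 <= v by exact: normr_ge0.
rewrite (_ : c * v = 2%:R * (c * v / 2)); last by field.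
rewrite expRM_natl.
have E1 : 1 + c * v / 2 <= expR (c * v / 2) by exact: expR_ge1Dx.
have cv : 0 <= c * v / 2 by rewrite divr_ge0// mulr_ge0// ltW.
have E2 : 1 + (c * v / 2) ^+ 2 <= expR (c * v / 2) ^+ 2 by nra.
apply: (@le_trans _ _ ((1 + 4 / c ^+ 2) * (1 + (c * v / 2) ^+ 2))).
  rewrite [leRHS](_ : _ = 1 + 4 / c ^+ 2 + (c * v / 2) ^+ 2 + v ^+ 2); last first.
    by field; rewrite gt_eqF.
  have : 0 <= 4 / c ^+ 2 by rewrite divr_ge0// sqr_ge0.
  by have := sqr_ge0 (c * v / 2); lra.
by rewrite ler_wpM2l// addr_ge0// divr_ge0// sqr_ge0.
Qed.

Lemma Fubini_halfline M N f g (s : R * R -> R) :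
  continuous f -> continuous g -> measurable_fun setT s ->
  (forall q, `|s q| <= 1) -> dominated M f -> dominated N g ->
  \int[mu]_(p in halfline) (f p * \int[mu]_(u in halfline) (s (p, u) * g u)) =
  \int[mu]_(u in halfline) (g u * \int[mu]_(p in halfline) (f p * s (p, u))).
Proof.
move=> cf cg ms s1 fM gN.
(* Extension by zero turns both half-line integrals into integrals over R. As |s| <= 1, the product
   of |f'| and |g'| is an integrable majorant on the plane. *)
pose f' := f \_ halfline; pose g' := g \_ halfline.
have mf' : measurable_fun setT f'.
  by apply/measurable_restrict => //; rewrite setTI; exact: measurable_continuous.
have mg' : measurable_fun setT g'.
  by apply/measurable_restrict => //; rewrite setTI; exact: measurable_continuous.
pose F (q : R * R) := (f' q.1 * (s q * g' q.2))%:E.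
have mF : measurable_fun setT F.
  apply/measurable_EFinP; apply: measurable_funM.
    exact: measurableT_comp mf' measurable_fst.
  by apply: measurable_funM => //; exact: measurableT_comp mg' measurable_snd.
have if' : mu.-integrable setT (EFin \o f').
  rewrite -restrict_EFin; apply/integrable_restrict => //; rewrite setTI.
  by apply: integrable_dominated fM; exact: measurable_continuous.
have ig' : mu.-integrable setT (EFin \o g').
  rewrite -restrict_EFin; apply/integrable_restrict => //; rewrite setTI.
  by apply: integrable_dominated gN; exact: measurable_continuous.
have msl p : measurable_fun setT (fun u => s (p, u)).
  by apply: measurableT_comp => //; exact: pair1_measurable.
have msr u : measurable_fun setT (fun p => s (p, u)).
  by apply: measurableT_comp => //; exact: pair2_measurable.
have LE p : (\int[mu]_u F (p, u) =
    (f' p * \int[mu]_(u in halfline) (s (p, u) * g u))%:E)%E.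
  have ig : mu.-integrable halfline (EFin \o (fun u => s (p, u) * g u)).
    apply: (integrable_dominated (M := N)).
      apply: measurable_funM; first exact: measurable_funTS (msl p).
      exact: measurable_continuous.
    by apply: dominated_mull gN => u _; exact: s1.
  rewrite EFinM fineK; last exact: integrable_fin_num ig.
  rewrite -integralZl// integral_mkcond; apply: eq_integral => u _.
  rewrite /F /g' !patchE/=; case: ifPn => _.
    by rewrite EFinM.
  by rewrite !mulr0.
have RE u : (\int[mu]_p F (p, u) =
    (g' u * \int[mu]_(p in halfline) (f p * s (p, u)))%:E)%E.
  have if_ : mu.-integrable halfline (EFin \o (fun p => f p * s (p, u))).
    apply: (integrable_dominated (M := M)).
      apply: measurable_funM; last exact: measurable_funTS (msr u).
      exact: measurable_continuous.
    under eq_fun do rewrite mulrC.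
    by apply: dominated_mull fM => p _; exact: s1.
  rewrite EFinM fineK; last exact: integrable_fin_num if_.
  rewrite -integralZl// integral_mkcond; apply: eq_integral => p _.
  rewrite /F /f' !patchE/=; case: ifPn => _.
    by rewrite EFinM -EFinM; congr EFin; ring.
  by rewrite mul0r.
have iF : (mu \x mu)%E.-integrable setT F.
  apply/integrable12ltyP => //.
  have /integrableP[_ lf] := if'; have /integrableP[_ lg] := ig'.
  have mf1 : measurable_fun setT (fun p => `|f' p|%:E).
    by apply/measurable_EFinP; apply: measurableT_comp.
  have mg1 : measurable_fun setT (fun u => `|g' u|%:E).
    by apply/measurable_EFinP; apply: measurableT_comp.
  have mA : measurable_fun setT (abse \o F) by exact: measurableT_comp.
  apply: (@le_lt_trans _ _ (\int[mu]_p (`|f' p|%:E *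
      \int[mu]_u `|g' u|%:E))%E).
    apply: ge0_le_integral => //.
    - by move=> p _; exact: integral_ge0.
    - exact: (@measurable_fun_fubini_tonelli_F _ _ _ _ R mu (abse \o F) mA (fun=> abse_ge0 _)).
    - by apply: emeasurable_funM => //; exact: measurable_cst.
    - move=> p _; rewrite -ge0_integralZl//.
      apply: ge0_le_integral => //.
      + by apply: (measurableT_comp mA); exact: pair1_measurable.
      + by apply: emeasurable_funM => //; exact: measurable_cst.
      + move=> u _; rewrite /F/= lee_fin !normrM ler_wpM2l//.
        by rewrite ler_piMl.
  rewrite ge0_integralZr//; last exact: integral_ge0.
  rewrite lte_mul_pinfty//.
  - exact: integral_ge0.
  - by rewrite ge0_fin_numE//; exact: integral_ge0.
have := Fubini iF.
under eq_integral do rewrite LE.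
under [in X in _ = X -> _]eq_integral do rewrite RE.
move=> E; rewrite Rintegral_mkcond [RHS]Rintegral_mkcond.
apply: (congr1 fine).
transitivity (\int[mu]_p
    (f' p * \int[mu]_(u in halfline) (s (p, u) * g u))%:E)%E.
  by apply: eq_integral => p _; rewrite /f' !patchE; case: ifPn => // _;
    rewrite mul0r.
rewrite E; apply: eq_integral => u _.
by rewrite /g' !patchE; case: ifPn => // _; rewrite mul0r.
Qed.

End fubini_halfline.

(** * Signs of the transforms below the real axis *)

Section kernels.
Context {R : realType}.
Notation mu := (@lebesgue_measure R).
Notation halfline := (`[0%R, +oo[%classic : set R).
Implicit Types (b f g h k : R -> R) (M N L c d e q u p x y z w : R).

(** The constant N depends on y, which confines the use of Fubini to points strictly below the real
    axis. *)
Lemma dominated_expN y : 0 < y -> exists2 N, 0 < N &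
  dominated N (fun p => expR (- (p * y))).
Proof.
move=> y0; have [N N0 H] := oneDsqr_le_expR 1 y0.
exists N => // p p0; rewrite ger0_norm ?expR_ge0// ler_pdivlMr ?oneDsqr_gt0//.
have := H p; rewrite expr1 ger0_norm// => {}H.
rewrite expRN mulrC ler_pdivrMr ?expR_gt0// (mulrC p)//.
Qed.

Lemma integral_expN_trig q y : 0 < y ->
  \int[mu]_(p in halfline) (expR (- (p * y)) * cos (p * q)) = y / (y ^+ 2 + q ^+ 2)
  /\ \int[mu]_(p in halfline) (expR (- (p * y)) * sin (p * q)) = q / (y ^+ 2 + q ^+ 2).
Proof.
move=> y0; have [N N0 H] := dominated_expN y0.
have Hc : dominated N (fun p => expR (- (p * y)) * cos (p * q)).
  under eq_fun do rewrite mulrC.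
  by apply: dominated_mull H => p _; exact: abs_cos_le1.
have Hs : dominated N (fun p => expR (- (p * y)) * sin (p * q)).
  under eq_fun do rewrite mulrC.
  by apply: dominated_mull H => p _; exact: abs_sin_le1.
have H0 : dominated N (fun=> 0).
  by move=> p p0; rewrite normr0 divr_ge0// ltW// oneDsqr_gt0.
have cc := @continuous_expN_cos R q y; have cs := @continuous_expN_sin R q y.
have c0 : continuous (fun _ : R => (0 : R)) by move=> ?; exact: cvg_cst.
have dc p : is_derive p 1 (fun p => expR (- (p * y)) * cos (p * q))
    (- y * (expR (- (p * y)) * cos (p * q))
    + - q * (expR (- (p * y)) * sin (p * q)) + 0).
  by apply: (is_derive_eq (is_derive_expN_cos q y p)); ring.
have ds p : is_derive p 1 (fun p => expR (- (p * y)) * sin (p * q))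
    (q * (expR (- (p * y)) * cos (p * q))
    + - y * (expR (- (p * y)) * sin (p * q)) + 0).
  by apply: (is_derive_eq (is_derive_expN_sin q y p)); ring.
have := integral_derive_lin dc cc cs c0 Hc Hc Hs H0.
have := integral_derive_lin ds cc cs c0 Hs Hc Hs H0.
rewrite !mul0r oppr0 expR0 cos0 sin0 !mul1r oppr0 Rintegral_cst// mul0r !addr0.
set C := \int[mu]_(p in _) _; set S := \int[mu]_(p in _) _.
move=> E1 E2; have D0 : 0 < y ^+ 2 + q ^+ 2 by rewrite ltr_wpDr ?sqr_ge0// exprn_gt0.
have D1 : y ^+ 2 + q ^+ 2 != 0 by rewrite gt_eqF.
split; apply: (mulIf D1); rewrite mulfVK//.
  (* Integrating the derivatives of the two products gives a linear system for C and S with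
     determinant y^2 + q^2, solved here by explicit combinations. *)
  rewrite (_ : C * _ = - y * (- y * C + - q * S) + q * (q * C + - y * S)).
    by rewrite E1 E2; ring.
  by ring.
rewrite (_ : S * _ = - q * (- y * C + - q * S) + - y * (q * C + - y * S)).
  by rewrite E1 E2; ring.
by ring.
Qed.

Lemma measurable_sinM (D : set (R * R)) : measurable_fun D (fun r : R * R => sin (r.1 * r.2)).
Proof.
apply: measurable_funTS; apply: measurableT_comp => //.
  exact: measurable_continuous (@continuous_sin R).
exact: measurable_funM.
Qed.

(** After Fubini, the product formula for sin (p x) sin (p u) yields a difference of two Poisson
    kernels. Over a common denominator it is visibly nonnegative for x, y, u >= 0. *)
Lemma lapS_sinT M b x y : 0 < y -> continuous b -> dominated M b ->
  lapS (sinT b) x y = \int[mu]_(u in halfline)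
    (b u * (2 * x * y * u / ((y ^+ 2 + (x - u) ^+ 2) * (y ^+ 2 + (x + u) ^+ 2)))).
Proof.
move=> y0 cb bM; have [N N0 H] := dominated_expN y0.
have Hs : dominated N (fun p => expR (- (p * y)) * sin (p * x)).
  under eq_fun do rewrite mulrC.
  by apply: dominated_mull H => p _; exact: abs_sin_le1.
have := @Fubini_halfline R N M _ _ (fun r : R * R => sin (r.1 * r.2))
  (@continuous_expN_sin R x y) cb (@measurable_sinM setT)
  (fun r : R * R => abs_sin_le1 _) Hs bM.
rewrite /= -/(lapS _ _ _) => ->; apply: eq_Rintegral => u _; congr (_ * _).
have iE q : mu.-integrable halfline (EFin \o (fun p => expR (- (p * y)) * cos (p * q))).
  apply: (integrable_dominated (M := N)).
    by apply: measurable_continuous; exact: continuous_expN_cos.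
  under eq_fun do rewrite mulrC.
  by apply: dominated_mull H => p _; exact: abs_cos_le1.
rewrite (_ : (fun p => _) = (fun p => 2^-1 * (expR (- (p * y)) * cos (p * (x - u)) -
  expR (- (p * y)) * cos (p * (x + u))))); last first.
  by apply/funext => p; rewrite (mulrBr p) (mulrDr p) cosB cosD; field.
rewrite RintegralZl//; last exact: (integrableB _ (iE _) (iE _)).
rewrite RintegralB//.
have [-> _] := integral_expN_trig (x - u) y0.
have [-> _] := integral_expN_trig (x + u) y0.
have D q : y ^+ 2 + q ^+ 2 != 0 by rewrite gt_eqF// ltr_wpDr ?sqr_ge0// exprn_gt0.
by field; rewrite !D.
Qed.

Lemma lapC0_sinT M b y : 0 < y -> continuous b -> dominated M b ->
  lapC (sinT b) 0 y = \int[mu]_(u in halfline) (b u * (u / (y ^+ 2 + u ^+ 2))).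
Proof.
move=> y0 cb bM; have [N N0 H] := dominated_expN y0.
have Hs : dominated N (fun p => expR (- (p * y)) * cos (p * 0)).
  under eq_fun do rewrite mulrC.
  by apply: dominated_mull H => p _; exact: abs_cos_le1.
have := @Fubini_halfline R N M _ _ (fun r : R * R => sin (r.1 * r.2))
  (@continuous_expN_cos R 0 y) cb (@measurable_sinM setT)
  (fun r : R * R => abs_sin_le1 _) Hs bM.
rewrite /= -/(lapC _ _ _) => ->; apply: eq_Rintegral => u _; congr (_ * _).
have [_ <-] := integral_expN_trig u y0.
by apply: eq_Rintegral => p _; rewrite mulr0 cos0 mulr1.
Qed.

Lemma integral_ge_itv h c d e : 0 <= c <= d -> 0 <= e ->
  mu.-integrable halfline (EFin \o h) -> (forall u, 0 <= u -> 0 <= h u) ->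
  (forall u, c <= u <= d -> e <= h u) ->
  e * (d - c) <= \int[mu]_(u in halfline) h u.
Proof.
move=> /andP[c0 cd] e0 ih h0 he.
rewrite -lee_fin /Rintegral fineK; last exact: integrable_fin_num ih.
have <- : (\int[mu]_(u in `[c, d]) (cst e%:E u) = (e * (d - c))%:E)%E.
  rewrite integral_cst//= lebesgue_measure_itv/= lte_fin.
  case: ifPn => [_|]; first by rewrite -EFinB EFinM.
  rewrite -leNgt => dc; have -> : c = d by apply/eqP; rewrite eq_le cd.
  by rewrite subrr mulr0 mule0.
have sub : `[c, d]%classic `<=` halfline.
  by move=> u /=; rewrite !in_itv/= andbT => /andP[cu _]; exact: le_trans cu.
have mh : measurable_fun halfline (EFin \o h) by exact: measurable_int ih.
apply: (@le_trans _ _ (\int[mu]_(u in `[c, d]) (h u)%:E)%E).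
  apply: ge0_le_integral => //.
  exact: measurable_funS mh.
apply: ge0_subset_integral => //.
by move=> u; rewrite /= in_itv/= andbT => u0; rewrite lee_fin h0.
Qed.

(** Only u in [x, x + min y d] is kept. There (x - u)^2 <= y^2, so the first denominator is at most
    2 y^2 and the kernel is at least of order 1 / y. For y <= d the interval has length y, so the
    bound does not degenerate as y tends to 0. *)
Lemma lapS_sinT_ge M b x y d e : 0 < y -> 0 < x -> 0 < d -> 0 <= e ->
  continuous b -> dominated M b -> (forall u, 0 <= u -> 0 <= b u) ->
  (forall u, x <= u <= x + d -> e <= b u) ->
  e * (x ^+ 2 / (y * (y ^+ 2 + (2 * x + d) ^+ 2))) * Num.min y d
  <= lapS (sinT b) x y.
Proof.
move=> y0 x0 d0 e0 cb bM b0 be; rewrite (lapS_sinT x y0 cb bM).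
have s0 : 0 < Num.min y d by rewrite lt_min y0.
have sy : Num.min y d <= y by rewrite ge_min lexx.
have sd : Num.min y d <= d by rewrite ge_min lexx orbT.
set s := Num.min y d in s0 sy sd *.
rewrite [X in _ * X](_ : s = x + s - x); last by ring.
have P q : 0 < y ^+ 2 + q ^+ 2 by rewrite ltr_wpDr ?sqr_ge0// exprn_gt0.
have K0 u : 0 <= u -> 0 <= 2 * x * y * u /
    ((y ^+ 2 + (x - u) ^+ 2) * (y ^+ 2 + (x + u) ^+ 2)).
  by move=> u0; rewrite divr_ge0 ?mulr_ge0// ltW.
apply: integral_ge_itv.
- by rewrite (ltW x0) lerDl ltW.
- by rewrite mulr_ge0// divr_ge0 ?sqr_ge0// mulr_ge0// ltW.
(* The kernel is at most 1 / y, because 2 x u <= (x + u)^2. *)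
- apply: (integrable_dominated (M := y^-1 * M)).
    apply: measurable_continuous; apply: continuous_mul => // u.
    have cq (c1 : R) : continuous (fun u => y ^+ 2 + (x + c1 * u) ^+ 2).
      move=> v; apply: cvgD; first exact: cvg_cst.
      apply: (@continuous_comp _ _ _ (fun v => x + c1 * v) (fun v => v ^+ 2));
        last exact: exprn_continuous.
      apply: cvgD; first exact: cvg_cst.
      exact: is_derive_continuous (is_derive_linl c1) v.
    apply: cvgM; first by apply: is_derive_continuous (is_derive_linl _) u.
    apply: cvgV; first by rewrite mulf_neq0// gt_eqF.
    apply: cvgM; last by have := cq 1 u; under eq_fun do rewrite mul1r.
    by have := cq (- 1) u; under eq_fun do rewrite mulN1r.
  move=> u u0; rewrite normrM mulrC -[leRHS]mulrA ler_pM// ?bM//.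
  rewrite ger0_norm ?K0// ler_pdivrMr ?mulr_gt0// ler_pdivlMl//.
  apply: (@le_trans _ _ (y ^+ 2 * (x + u) ^+ 2)).
    by rewrite (_ : y * _ = y ^+ 2 * (2 * x * u)); [rewrite ler_wpM2l ?sqr_ge0//; nra|ring].
  by rewrite ler_pM ?sqr_ge0// ?lerDl ?lerDr ?sqr_ge0.
- by move=> u u0; rewrite mulr_ge0 ?b0 ?K0.
- move=> u /andP[xu us]; have u0 : 0 < u by exact: lt_le_trans xu.
  apply: ler_pM => //.
  + by rewrite divr_ge0 ?sqr_ge0// mulr_ge0// ltW.
  + by rewrite be// xu/= (le_trans us)// lerD2l.
  rewrite ler_pdivlMr ?mulr_gt0// mulrAC ler_pdivrMr ?mulr_gt0//.
  have A1 : y ^+ 2 + (x - u) ^+ 2 <= 2 * y ^+ 2 by nra.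
  have A2 : y ^+ 2 + (x + u) ^+ 2 <= y ^+ 2 + (2 * x + d) ^+ 2 by nra.
  apply: (@le_trans _ _ (x * u * ((2 * y ^+ 2) * (y ^+ 2 + (2 * x + d) ^+ 2)))).
    by rewrite ler_pM ?ler_pM ?mulr_ge0 ?sqr_ge0// ?ltW.
  by rewrite le_eqVlt; apply/orP; left; apply/eqP; ring.
Qed.

(** Below the axis the signs are read off the kernels. On the axis itself they come from the
    Lipschitz estimate: a weak inequality passes to the limit, and the strict one survives thanks to
    the lower bound uniform in the height. *)
Lemma lap_sinT_sign M K b : continuous b -> dominated M b ->
  (forall u, 0 <= u -> 0 <= b u) ->
  dominated K (sinT b) -> dominated K (fun p => p * sinT b p) ->
  continuous (sinT b) ->
  (forall y, 0 <= y -> 0 <= lapC (sinT b) 0 y) /\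
  (forall x y, 0 < x -> 0 <= y -> 0 < b x -> 0 < lapS (sinT b) x y).
Proof.
move=> cb bM b0 gK pgK cg.
pose L := K * (pi / 2).
have L0 : 0 <= L.
  by rewrite mulr_ge0 ?(dominated_ge0 gK)// divr_ge0 ?pi_ge0.
have C0 y : 0 < y -> 0 <= lapC (sinT b) 0 y.
  move=> y0; rewrite (lapC0_sinT y0 cb bM); apply: Rintegral_ge0 => u.
  rewrite /= in_itv/= andbT => u0.
  by rewrite mulr_ge0 ?b0 ?divr_ge0// addr_ge0 ?sqr_ge0.
split=> [y|x y x0 y0 bx].
  rewrite le_eqVlt => /predU1P[<-|/C0//].
  apply/ler_addgt0Pr => e e0; rewrite -lerBlDr sub0r.
  (* At this height the Lipschitz estimate, of constant L, costs at most e. *)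
  have eL : 0 < e / (L + 1) by rewrite divr_gt0// ltr_wpDl.
  have := lapC_lipschitz 0 0 (ltW eL) (lexx 0) cg gK pgK.
  rewrite subrr normr0 add0r subr0 (ger0_norm (ltW eL)) -/L ler_norml.
  move=> /andP[_ H]; have := C0 _ eL.
  have : e / (L + 1) * L <= e.
    by rewrite mulrAC ler_pdivrMr ?ltr_wpDl// ler_wpM2l ?(ltW e0)// lerDl.
  by lra.
have [d d0 be] : exists2 d, 0 < d & forall u, x <= u <= x + d -> b x / 2 <= b u.
  have := cb x; move/cvgrPdist_le => /(_ (b x / 2)).
  rewrite divr_gt0// => /(_ isT)/nbhs_ballP[r/= r0 rb].
  exists (r / 2) => [|u /andP[xu ur]]; first by rewrite divr_gt0.
  have : ball x r u.
    by rewrite /ball/= ler0_norm ?subr_le0//; move: r0 ur; lra.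
  by move=> /rb/=; rewrite ler_norml => /andP[_]; lra.
have e0 : 0 <= b x / 2 by rewrite divr_ge0// ltW.
have ge z : 0 < z -> 0 < lapS (sinT b) x z.
  move=> z0; apply: lt_le_trans (lapS_sinT_ge z0 x0 d0 e0 cb bM b0 be).
  rewrite mulr_gt0 ?lt_min ?z0// mulr_gt0 ?divr_gt0 ?exprn_gt0// mulr_gt0//.
  by rewrite ltr_wpDr ?sqr_ge0// exprn_gt0.
move: y0; rewrite le_eqVlt => /predU1P[<-|/ge//].
(* This is a lower bound at every height z <= d: the factor min z d = z cancels the 1 / z of
   [lapS_sinT_ge], and z is replaced by d in the remaining denominator. *)
pose c := b x / 2 * (x ^+ 2 / (d ^+ 2 + (2 * x + d) ^+ 2)).
have c0 : 0 < c.
  rewrite mulr_gt0 ?divr_gt0 ?exprn_gt0// ltr_wpDr ?sqr_ge0// exprn_gt0//.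
(* Moving from height z to 0 costs at most z L <= c / 2, so a positive amount remains. *)
pose z := Num.min d (c / (2 * (L + 1))).
have cL : 0 < c / (2 * (L + 1)) by rewrite divr_gt0// mulr_gt0// ltr_wpDl.
have z0 : 0 < z by rewrite lt_min d0.
have zd : z <= d by rewrite ge_min lexx.
have zc : z * (2 * (L + 1)) <= c.
  by rewrite -ler_pdivlMr ?mulr_gt0 ?ltr_wpDl// ge_min lexx orbT.
have G : c <= lapS (sinT b) x z.
  apply: le_trans (lapS_sinT_ge z0 x0 d0 e0 cb bM b0 be).
  have P q w : 0 < w -> 0 < w ^+ 2 + q ^+ 2.
    by move=> w0; rewrite ltr_wpDr ?sqr_ge0// exprn_gt0.
  rewrite (min_idPl zd) [leRHS](_ : _ =
      b x / 2 * (x ^+ 2 / (z ^+ 2 + (2 * x + d) ^+ 2))); last first.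
    by field; rewrite !gt_eqF// P.
  rewrite /c ler_wpM2l// ler_wpM2l ?sqr_ge0// lef_pV2 ?posrE ?P// lerD2r.
  by rewrite lerXn2r ?nnegrE// ltW.
have := lapS_lipschitz x x (lexx 0) (ltW z0) cg gK pgK.
rewrite subrr normr0 add0r sub0r normrN (ger0_norm (ltW z0)) -/L ler_norml.
by move=> /andP[H _]; nra.
Qed.

End kernels.

(** * Compactness *)

Section lower_bound.
Context {R : realType}.
Implicit Types (A B : R -> R -> R) (L D r t x y : R).

(** The estimate is known only for y >= 0. Reflecting the second coordinate by the absolute value
    gives a function continuous on the whole space, as the extreme value theorem is applied
    there. *)
Lemma continuous_lipschitz_coord A L :
  (forall x x' y y', 0 <= y -> 0 <= y' ->
    `|A x y - A x' y'| <= (`|x - x'| + `|y - y'|) * L) ->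
  continuous (fun v : 'rV[R]_3 => A (v 0 0) `|v 0 1|).
Proof.
move=> AL v.
have L0 : 0 <= L.
  have := AL 0 1 0 0 (lexx _) (lexx _).
  by rewrite subrr sub0r normr0 addr0 normrN normr1 mul1r; exact: le_trans.
have F : Filter (nbhs v) by exact: nbhs_filter.
apply/(@cvgrPdist_le _ _ _ (nbhs v) F) => e e0.
have d0 : 0 < e / (2 * (L + 1)) by rewrite divr_gt0// mulr_gt0// ltr_wpDl.
have c i := @coord_continuous R 1 3 0 i v.

near=> w.
have w0 : `|v 0 0 - w 0 0| <= e / (2 * (L + 1)).
  by near: w; have /cvgrPdist_le := c 0; exact.
have w1 : `|v 0 1 - w 0 1| <= e / (2 * (L + 1)).
  by near: w; have /cvgrPdist_le := c 1; exact.
apply: (le_trans (AL _ _ _ _ _ _)) => //.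
apply: (@le_trans _ _ ((e / (2 * (L + 1)) + e / (2 * (L + 1))) * L)).
  rewrite ler_wpM2r// lerD// (le_trans _ w1)//.
  exact: ler_dist_dist.
rewrite (_ : _ * L = e * (L / (L + 1))); last first.
  by field; rewrite gt_eqF// ltr_wpDl.
by rewrite ler_piMr ?(ltW e0)// ler_pdivrMr ?ltr_wpDl// mul1r lerDl.
Unshelve. all: by end_near. Qed.

(** Here A + i B is minus the complex conjugate of a, so the bounded quantity is the squared modulus
    of 1 - t a. The radius r depends on D alone, whereas kappa comes from a minimum over a compact
    box and depends on A and B. *)
Lemma lower_bound_closed_halfplane A B L D r :
  (forall x x' y y', 0 <= y -> 0 <= y' ->
    `|A x y - A x' y'| <= (`|x - x'| + `|y - y'|) * L) ->
  (forall x x' y y', 0 <= y -> 0 <= y' ->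
    `|B x y - B x' y'| <= (`|x - x'| + `|y - y'|) * L) ->
  (forall x y, 0 <= y -> (x ^+ 2 + y ^+ 2) * (A x y ^+ 2 + B x y ^+ 2) <= D) ->
  0 < r -> 4 * D <= r ^+ 2 ->
  (forall y, 0 <= y -> 0 <= A 0 y) ->
  (forall x y, 0 < x <= r -> 0 <= y -> 0 < B x y) ->
  exists2 kappa : R, 0 < kappa & forall x y t, 0 <= x -> 0 <= y -> 0 <= t <= 1 ->
    kappa <= (1 + t * A x y) ^+ 2 + (t * B x y) ^+ 2.
Proof.
move=> AL BL AB r0 rD A0 B0.
pose Phi (v : 'rV[R]_3) := (1 + v 0 2%R * A (v 0 0) `|v 0 1|) ^+ 2 +
  (v 0 2%R * B (v 0 0) `|v 0 1|) ^+ 2.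
pose bnd (i : 'I_3) := if i == 2%R then 1 else r.
pose K := [set v : 'rV[R]_3 | forall i, `[0, bnd i]%classic (v ord0 i)].
have cK : compact K.
  by apply: (@rV_compact R 3 (fun i => `[0, bnd i]%classic)) => i; exact: segment_compact.
have K0 : K !=set0.
  exists 0 => i /=; rewrite mxE in_itv/= lexx /bnd.
  by case: ifP => _; [exact: ler01|exact: ltW].
have cPhi : continuous Phi.
  move=> v.
  have cA := continuous_lipschitz_coord AL (x := v).
  have cB := continuous_lipschitz_coord BL (x := v).
  have ct := @coord_continuous R 1 3 0 2%R v.
  have F : Filter (nbhs v) by exact: nbhs_filter.
  have c1 := cvgD (FF := F) (cvg_cst (1 : R) (FF := F)) (cvgM (FF := F) ct cA).
  have c2 := cvgM (FF := F) ct cB.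
  exact: cvgD (cvgM (FF := F) c1 c1) (cvgM (FF := F) c2 c2).
have [v /set_mem Kv vmin] := compact_EVT_min K0 cK (continuous_subspaceT cPhi).
have Kv0 : 0 <= v 0 0 <= r by have := Kv 0; rewrite /= in_itv.
have Kv1 : 0 <= v 0 1 <= r by have := Kv 1; rewrite /= in_itv.
have Kv2 : 0 <= v 0 2%R <= 1 by have := Kv 2%R; rewrite /= in_itv.
have Phi0 : 0 < Phi v.
  (* On x = 0 the real part is at least 1, as A >= 0. For x > 0 the imaginary part is positive,
     unless t = 0, where the value is 1. *)
  rewrite /Phi; have [v00 v0r] := andP Kv0.
  have [v20 v21] := andP Kv2.
  have := v00; rewrite le_eqVlt => /predU1P[E|v0gt].
    rewrite -E; have := A0 `|v 0 1| (normr_ge0 _) => A0'.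
    by rewrite ltr_wpDr ?sqr_ge0// exprn_gt0// ltr_wpDr// mulr_ge0.
  have B1 : 0 < B (v 0 0) `|v 0 1| by apply: B0; rewrite ?v0gt.
  have := v20; rewrite le_eqVlt => /predU1P[<-|v2gt].
    by rewrite !mul0r addr0 expr1n expr0n/= addr0.
  by rewrite ltr_wpDl ?sqr_ge0// exprn_gt0// mulr_gt0.
(* Outside the box A^2 + B^2 <= 1 / 4, so the real part is at least 1 - 1 / 2; its square is the 1 /
   4. *)
exists (Num.min (Phi v) (1 / 4)); first by rewrite lt_min Phi0 divr_gt0.
move=> x y t x0 y0 /andP[t0 t1].
have [/andP[xr yr]|] := boolP ((x <= r) && (y <= r)).
  pose w : 'rV[R]_3 := \row_(i < 3) [:: x; y; t]`_i.
  have w0 : w 0 0 = x by rewrite mxE.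
  have w1 : w 0 1 = y by rewrite mxE.
  have w2 : w 0 2%R = t by rewrite mxE.
  have Kw : K w.
    move=> i; have [->|->|->] : [\/ i = 0, i = 1 | i = 2%R].
      by case: i => [[|[|[|//]]]] j; [apply: Or31|apply: Or32|apply: Or33]; apply/val_inj.
    - by rewrite /= w0 in_itv/= x0.
    - by rewrite /= w1 in_itv/= y0.
    - by rewrite /= w2 in_itv/= t0.
  have := vmin w; rewrite inE => /(_ Kw); rewrite /Phi w0 w1 w2 (ger0_norm y0).
  by rewrite ge_min => ->.
rewrite negb_and -!ltNge => xy.
have big : 4 * D <= x ^+ 2 + y ^+ 2.
  apply: (le_trans rD); case/orP: xy => h.
    by rewrite ler_wpDr ?sqr_ge0// lerXn2r ?nnegrE ?(ltW r0) ?(ltW h)//.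
  by rewrite ler_wpDl ?sqr_ge0// lerXn2r ?nnegrE ?(ltW r0) ?(ltW h)//.
have pos : 0 < x ^+ 2 + y ^+ 2.
  case/orP: xy => h.
    by rewrite ltr_wpDr ?sqr_ge0// exprn_gt0// (lt_trans r0).
  by rewrite ltr_wpDl ?sqr_ge0// exprn_gt0// (lt_trans r0).
have q : 4 * (A x y ^+ 2 + B x y ^+ 2) <= 1.
  rewrite -(ler_pM2l pos) mulr1 mulrCA (le_trans _ big)//.
  by rewrite ler_wpM2l// AB.
rewrite ge_min; apply/orP; right.
have A2 : A x y ^+ 2 <= 1 / 4 by have := sqr_ge0 (B x y); lra.
have Ab : - (1 / 2) <= A x y by nra.
have tA : - (1 / 2) <= t * A x y by nra.
have := sqr_ge0 (t * B x y); nra.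
Qed.

End lower_bound.

(** * The transform of a radial density *)

Section profile.
Context {R : realType}.
Implicit Types (f : nat -> R -> R) (N p t u x y : R).

(** The third power leaves room for a weight u^2 and for the power spent in bounding the tail
    integral. *)
Definition decaying N (h : R -> R) := forall u, `|h u| <= N / oneDsqr u ^+ 3.

Lemma decaying_dominated N j (h : R -> R) : (j <= 2)%N -> decaying N h ->
  dominated N (fun u => u ^+ j * h u).
Proof.
move=> j2 hN u u0; rewrite normrM.
have o1 : 1 <= oneDsqr u by exact: oneDsqr_ge1.
have o0 : 0 < oneDsqr u by exact: oneDsqr_gt0.
have N0 : 0 <= N.
  by have := hN 0; rewrite /oneDsqr expr0n/= addr0 expr1n divr1; exact: le_trans.
have uj : `|u ^+ j| <= oneDsqr u.
  rewrite ger0_norm ?exprn_ge0// /oneDsqr; move: j j2 => [|[|[|//]]] _.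
  - by rewrite expr0 lerDl sqr_ge0.
  - by rewrite expr1; nra.
  - by rewrite lerDr.
apply: (@le_trans _ _ (oneDsqr u * (N / oneDsqr u ^+ 3))).
  by apply: ler_pM.
rewrite mulrCA ler_wpM2l//.
have -> : oneDsqr u / oneDsqr u ^+ 3 = (oneDsqr u)^-1 * (oneDsqr u)^-1.
  by field; rewrite gt_eqF.
by rewrite ler_piMl ?invr_ge0 ?(ltW o0)// invf_le1.
Qed.

(** The density 4 pi u^2 f(u) of the radius, divided by u; the division reflects the spherical mean
    sin (p u) / (p u) of a plane wave. *)
Definition radial_density f u : R := 4 * pi * (u * f 0%N u).

Section transform.
Variables (f : nat -> R -> R) (N : R).
Hypothesis f_derive : forall k u, is_derive u 1 (f k) (f k.+1 u).
Hypothesis f_decay : forall k, (k <= 3)%N -> decaying N (f k).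
Hypothesis f10 : f 1%N 0 = 0.

Let kappa : R := 4 * pi.
(** The number 7 is the largest sum of coefficients in the functions below, reached by [c2] as 2 + 4
    + 1. The b's are successive derivatives of the density b0, the c's those of u b0, whose cosine
    transform is the derivative of the sine transform of b0. *)
Let M : R := kappa * (7 * N).
Let b0 u := kappa * (u * f 0%N u).
Let b1 u := kappa * (f 0%N u + u * f 1%N u).
Let b2 u := kappa * (2 * f 1%N u + u * f 2%N u).
Let b3 u := kappa * (3 * f 2%N u + u * f 3%N u).
Let c0 u := u * b0 u.
Let c1 u := kappa * (2 * (u * f 0%N u) + u ^+ 2 * f 1%N u).
Let c2 u := kappa * (2 * f 0%N u + 4 * (u * f 1%N u) + u ^+ 2 * f 2%N u).

Let kappa0 : 0 <= kappa.
Proof. by rewrite mulr_ge0// pi_ge0. Qed.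

Let mono j k : (j <= 2)%N -> (k <= 3)%N ->
  dominated N (fun u => u ^+ j * f k u).
Proof. by move=> j2 k3; apply: decaying_dominated => //; exact: f_decay. Qed.

Let domM (a0 a1 a2 : R) (k0 k1 k2 : nat) (h : R -> R) :
  (k0 <= 3)%N -> (k1 <= 3)%N -> (k2 <= 3)%N ->
  0 <= a0 -> 0 <= a1 -> 0 <= a2 -> a0 + a1 + a2 <= 7 ->
  (forall u, h u = kappa * (a0 * f k0 u + a1 * (u * f k1 u) + a2 * (u ^+ 2 * f k2 u))) ->
  dominated M h.
Proof.
move=> k03 k13 k23 a00 a10 a20 a7 hE u u0; rewrite hE normrM (ger0_norm kappa0) /M -2!mulrA.
rewrite ler_wpM2l//.
have m0 : `|f k0 u| <= N / oneDsqr u.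
  by have := mono (leq0n 2) k03 u0; rewrite expr0 mul1r.
have m1 : `|u * f k1 u| <= N / oneDsqr u.
  by have := mono (leqnSn 1) k13 u0; rewrite expr1.
have m2 := mono (leqnn 2) k23 u0.
set w := N / oneDsqr u in m0 m1 m2 *.
have w0 : 0 <= w by exact: le_trans m0.
rewrite (le_trans (ler_normD _ _))// (@le_trans _ _ ((a0 + a1 + a2) * w))//.
  rewrite !mulrDl; apply: lerD; last by rewrite normrM (ger0_norm a20) ler_wpM2l.
  rewrite (le_trans (ler_normD _ _))//.
  by rewrite !normrM (ger0_norm a00) (ger0_norm a10) -normrM lerD ?ler_wpM2l.
by rewrite ler_wpM2r.
Qed.

Let dom_b0 : dominated M b0.
Proof.
apply: (@domM 0 1 0 0 0 0) => //; first by rewrite addr0 add0r; lra.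
by move=> u; rewrite /b0; ring.
Qed.

Let dom_b1 : dominated M b1.
Proof. by apply: (@domM 1 1 0 0 1 0) => // [|u]; [lra|rewrite /b1; ring]. Qed.

Let dom_b2 : dominated M b2.
Proof. by apply: (@domM 2 1 0 1 2 0) => // [|u]; [lra|rewrite /b2; ring]. Qed.

Let dom_b3 : dominated M b3.
Proof. by apply: (@domM 3 1 0 2 3 0) => // [|u]; [lra|rewrite /b3; ring]. Qed.

Let dom_c0 : dominated M c0.
Proof.
by apply: (@domM 0 0 1 0 0 0) => // [|u]; [lra|rewrite /c0 /b0; ring].
Qed.

Let dom_c1 : dominated M c1.
Proof. by apply: (@domM 0 2 1 0 0 1) => // [|u]; [lra|rewrite /c1; ring]. Qed.

Let dom_c2 : dominated M c2.
Proof. by apply: (@domM 2 4 1 0 1 2) => // [|u]; [lra|rewrite /c2; ring]. Qed.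

Let db0 u : is_derive u 1 b0 (b1 u).
Proof.
apply: (is_derive_eq (is_derive_mull _ (is_derive_mul (is_derive_id u 1) (f_derive 0 u)))).
by rewrite /b1; ring.
Qed.

Let db1 u : is_derive u 1 b1 (b2 u).
Proof.
apply: (is_derive_eq (is_derive_mull _ (is_derive_add (f_derive 0 u)
  (is_derive_mul (is_derive_id u 1) (f_derive 1 u))))).
by rewrite /b2; ring.
Qed.

Let db2 u : is_derive u 1 b2 (b3 u).
Proof.
apply: (is_derive_eq (is_derive_mull _ (is_derive_add
  (is_derive_mull _ (f_derive 1 u))
  (is_derive_mul (is_derive_id u 1) (f_derive 2 u))))).
by rewrite /b3; ring.
Qed.

Let dc0 u : is_derive u 1 c0 (c1 u).
Proof.
apply: (is_derive_eq (is_derive_mul (is_derive_id u 1) (db0 u))).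
by rewrite /c1 /b0 /b1; ring.
Qed.

Let dc1 u : is_derive u 1 c1 (c2 u).
Proof.
have dsq : is_derive u 1 (fun u => u ^+ 2) (u + u).
  have H := is_derive_mul (is_derive_id u 1) (is_derive_id u 1).
  under eq_fun do rewrite expr2.
  by apply: (is_derive_eq H); ring.
apply: (is_derive_eq (is_derive_mull _ (is_derive_add
  (is_derive_mull _ (is_derive_mul (is_derive_id u 1) (f_derive 0 u)))
  (is_derive_mul dsq (f_derive 1 u))))).
by rewrite /c2; ring.
Qed.

Let cf k : continuous (f k).
Proof. exact: is_derive_continuous (f_derive k). Qed.

Let cb3 : continuous b3.
Proof.
move=> u; apply: cvgM; first exact: cvg_cst.
apply: cvgD; apply: cvgM; [exact: cvg_cst|exact: cf|exact: cvg_id|exact: cf].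
Qed.

Let cc2 : continuous c2.
Proof.
move=> u; apply: cvgM; first exact: cvg_cst.
apply: cvgD; [apply: cvgD|]; apply: cvgM; try exact: cvg_cst; try exact: cf.
  apply: cvgM; [exact: cvg_id|exact: cf].
exact: exprn_continuous.
Qed.

(** The boundary conditions are b0(0) = 0 for the transform and c1(0) = 0 for its derivative.
    Multiplication by p turns the sine transform of b0 into the cosine transform of b1, whose decay
    needs b2(0) = 0, that is f'(0) = 0. *)
Lemma radial_density_transform :
  [/\ continuous (radial_density f), dominated M (radial_density f) &
    [/\ forall p, is_derive p 1 (sinT (radial_density f))
         (cosT (fun u => u * radial_density f u) p),
      continuous (cosT (fun u => u * radial_density f u)),
      dominated (M * pi) (sinT (radial_density f)),
      dominated (M * pi) (cosT (fun u => u * radial_density f u)) &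
      dominated (M * pi) (fun p => p * sinT (radial_density f) p)]].
Proof.
have bE : radial_density f = b0 by [].
have cE : (fun u => u * radial_density f u) = c0 by [].
have b00 : b0 0 = 0 by rewrite /b0 mul0r mulr0.
rewrite cE bE; split.
- exact: is_derive_continuous db0.
- exact: dom_b0.
split.
- by move=> p; apply: is_derive_sinT dom_b0 dom_c0; exact: is_derive_continuous db0.
- by apply: continuous_cosT dom_c0; exact: is_derive_continuous dc0.
- move=> p _; apply: (sinT_decay p db0 db1 _ dom_b0 dom_b1 dom_b2) => //.
  exact: is_derive_continuous db2.
- move=> p _; apply: (cosT_decay p dc0 dc1 cc2 dom_c0 dom_c1 dom_c2).
  by rewrite /c1 mul0r expr0n/= mul0r mulr0 addr0 mulr0.
- move=> p _; rewrite (sinT_derive p db0 _ dom_b0 dom_b1); last first.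
    exact: is_derive_continuous db1.
  rewrite b00 addr0.
  apply: (cosT_decay p db1 db2 cb3 dom_b1 dom_b2 dom_b3).
  by rewrite /b2 f10 mul0r mulr0 addr0 mulr0.
Qed.

End transform.

Lemma profile_lower_bound N : exists2 r, 0 < r & forall f,
  (forall k u, is_derive u 1 (f k) (f k.+1 u)) ->
  (forall k, (k <= 3)%N -> decaying N (f k)) -> f 1%N 0 = 0 ->
  (forall u, 0 <= f 0%N u) -> (forall u, 0 <= u <= r -> 0 < f 0%N u) ->
  exists2 kappa : R, 0 < kappa & forall x y t, 0 <= y -> 0 <= t <= 1 ->
    kappa <= (1 + t * lapC (sinT (radial_density f)) x y) ^+ 2 +
             (t * lapS (sinT (radial_density f)) x y) ^+ 2.
Proof.
pose K := 4 * pi * (7 * N) * pi.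
pose D := 2 * (K * (pi / 2)) ^+ 2.
have D0 : 0 <= D by rewrite mulr_ge0// sqr_ge0.
(* D is the right-hand side of [lap_decay] and depends on N only; 1 + 4 D is positive even for D = 0
   and its square exceeds 4 D. *)
exists (1 + 4 * D); first by rewrite ltr_wpDr// mulr_ge0.
move=> f df fN f10 f0 fpos.
have [cb bM [dg cg1 gK g1K pgK]] := radial_density_transform df fN f10.
have cg := is_derive_continuous dg.
have b0 u : 0 <= u -> 0 <= radial_density f u.
  by move=> u0; rewrite /radial_density !mulr_ge0// pi_ge0.
have [A0 B0] := lap_sinT_sign cb bM b0 gK pgK cg.
have g0 : sinT (radial_density f) 0 = 0.
  rewrite /sinT (_ : (fun u => _) = (fun=> 0)); last first.
    by apply/funext => u; rewrite mul0r sin0 mul0r.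
  by rewrite Rintegral_cst// mul0r.
have [|||||||kappa kappa0 H] := @lower_bound_closed_halfplane R
  (lapC (sinT (radial_density f))) (lapS (sinT (radial_density f)))
  (K * (pi / 2)) D (1 + 4 * D).
- by move=> *; exact: lapC_lipschitz.
- by move=> *; exact: lapS_lipschitz.
- by move=> x y y0; exact: lap_decay dg cg1 gK g1K g0.
- by rewrite ltr_wpDr// mulr_ge0.
- by nra.
- exact: A0.
- move=> x y /andP[x0 xr] y0; apply: B0 => //.
  by rewrite /radial_density !mulr_gt0// ?pi_gt0// fpos// (ltW x0).
exists kappa => // x y t y0 t01.
have [x0|x0] := leP 0 x; first exact: H.
have nx0 : 0 <= - x by rewrite oppr_ge0 ltW.
have := H (- x) y t nx0 y0 t01.
have -> : lapC (sinT (radial_density f)) (- x) y = lapC (sinT (radial_density f)) x y.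
  by apply: eq_Rintegral => p _; rewrite mulrN cosN.
suff -> : lapS (sinT (radial_density f)) (- x) y = - lapS (sinT (radial_density f)) x y.
  by rewrite mulrN sqrrN.
rewrite /lapS -[RHS]mulN1r -RintegralZl//; last exact: integrable_lapS gK.
by apply: eq_Rintegral => p _; rewrite mulrN sinN; ring.
Qed.

End profile.

(** * The tail integral *)

Section tail_integral.
Context {R : realType}.
Notation mu := (@lebesgue_measure R).
Notation halfline := (`[0%R, +oo[%classic : set R).
Implicit Types (N p s t u x y : R).

Lemma integralT_even (h : R -> R) : (forall x, 0 <= h x) -> continuous h ->
  (forall x, h (- x) = h x) ->
  (\int[mu]_x (h x)%:E = 2%:E * \int[mu]_(x in halfline) (h x)%:E)%E.
Proof.
move=> h0 ch he; rewrite ge0_symfun_integralT//; last by move=> x /=; rewrite he.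
by rewrite set_itvcy.
Qed.

Lemma integralT_oneDsqrV : (\int[mu]_x ((oneDsqr x)^-1)%:E = pi%:E)%E.
Proof.
rewrite integralT_even.
- by rewrite integral0y_oneDsqr -EFinM; congr EFin; field.
- by move=> x; rewrite invr_ge0 ltW// oneDsqr_gt0.
- by move=> x; exact: continuous_oneDsqrV.
- by move=> x; rewrite /oneDsqr sqrrN.
Qed.

Lemma integrableT_dominated N (h : R -> R) : measurable_fun setT h ->
  (forall u, `|h u| <= N / oneDsqr u) -> mu.-integrable setT (EFin \o h).
Proof.
move=> mh hN.
have iw : mu.-integrable setT (EFin \o (fun u : R => (oneDsqr u)^-1)).
  apply/integrableP; split; first by apply/measurable_EFinP; exact: measurable_oneDsqrV.
  rewrite (_ : (fun x => _) = (fun x : R => (oneDsqr x)^-1%:E)).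
    by rewrite integralT_oneDsqrV ltry.
  by apply/funext => x /=; rewrite ger0_norm// invr_ge0 ltW// oneDsqr_gt0.
apply: (le_integrable _ _ _ (integrableZl _ N iw)) => //.
  exact/measurable_EFinP.
by move=> u _ /=; rewrite lee_fin (le_trans (hN u))// ler_norm.
Qed.

Variables (phi : R -> R) (N : R).
Hypothesis phi_cont : continuous phi.
Hypothesis phi_ge0 : forall u, 0 <= phi u.
Hypothesis phi_decay : decaying N phi.

(** Up to the factor 2 pi, the marginal along an axis of the radial function with profile phi. *)
Definition tail_integral u := \int[mu]_(s in `]u, +oo[) (s * phi s).

Let cont_sphi : continuous (fun s => s * phi s).
Proof. by move=> s; apply: cvgM; [exact: cvg_id|exact: phi_cont]. Qed.

Let N0 : 0 <= N.
Proof.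
by have := phi_decay 0; rewrite /oneDsqr expr0n/= addr0 expr1n divr1; exact: le_trans.
Qed.

Let sphi_le s : `|s * phi s| <= N / oneDsqr s / oneDsqr s.
Proof.
have o0 : 0 < oneDsqr s by exact: oneDsqr_gt0.
rewrite normrM (_ : _ / _ / _ = oneDsqr s * (N / oneDsqr s ^+ 3)); last first.
  by field; rewrite gt_eqF.
apply: ler_pM => //; rewrite /oneDsqr -(real_normK (num_real s)).
by have := normr_ge0 s; nra.
Qed.

Let sphi_integrable : mu.-integrable setT (EFin \o (fun s => s * phi s)).
Proof.
apply: (integrableT_dominated (N := N)); first exact: measurable_continuous.
move=> s; apply: (le_trans (sphi_le s)); apply: ler_piMr.
  by rewrite divr_ge0// ltW// oneDsqr_gt0.
by rewrite invf_le1// ?oneDsqr_ge1// oneDsqr_gt0.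
Qed.

Lemma is_derive_tail u : is_derive u 1 tail_integral (- (u * phi u)).
Proof.
(* The total integral minus the integral up to x, to which the first fundamental theorem applies. *)
have tE x : tail_integral x = \int[mu]_s (s * phi s) -
    \int[mu]_(s in [set` Interval -oo%O (BRight x)]) (s * phi s).
  rewrite /tail_integral -set_itvNyy Rintegral_itvB//; rewrite set_itvNyy//.
have i : mu.-integrable [set` Interval -oo%O (BRight (u + 1))]
    (EFin \o (fun s => s * phi s)).
  exact: integrableS sphi_integrable.
have uu : u < u + 1 by rewrite ltrDl.
have [d1 d2] := continuous_FTC1 uu i (ltNyr _) (@cont_sphi u).
have D : is_derive u 1 (fun x => \int[mu]_(s in [set` Interval -oo%O (BRight x)]) (s * phi s)) (u * phi u).
  by apply: DeriveDef => //; rewrite -derive1E.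
rewrite (_ : tail_integral = (fun x => \int[mu]_s (s * phi s) +
    - \int[mu]_(s in [set` Interval -oo%O (BRight x)]) (s * phi s))); last first.
  by apply/funext => x; rewrite tE.
apply: (is_derive_eq (is_derive_add (is_derive_cst _ u 1) (is_derive_opp D))).
by rewrite add0r.
Qed.

Lemma continuous_tail : continuous tail_integral.
Proof. exact: is_derive_continuous is_derive_tail. Qed.

Lemma tail_ge0 u : 0 <= u -> 0 <= tail_integral u.
Proof.
move=> u0; apply: Rintegral_ge0 => s; rewrite /= in_itv/= andbT => us.
by rewrite mulr_ge0// (le_trans u0)// ltW.
Qed.

(** Of the two factors 1 / (1 + s^2) bounding s phi(s), one is at most 1 / (1 + u^2) on the tail;
    the other integrates to at most pi / 2. *)
Lemma dominated_tail : dominated (N * (pi / 2)) tail_integral.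
Proof.
move=> u u0; rewrite /tail_integral.
have -> : `]u, +oo[%classic = halfline `&` `]u, +oo[%classic :> set R.
  rewrite setIidr// => s /=; rewrite !in_itv/= !andbT => us.
  by rewrite (le_trans u0)// ltW.
rewrite Rintegral_mkcondr mulrAC; apply: integral_dominated.
  apply/measurable_restrict => //; exact: measurable_continuous.
move=> s s0; rewrite patchE; case: ifPn => us; last first.
  by rewrite normr0 !divr_ge0// ltW// oneDsqr_gt0.
apply: (le_trans (sphi_le s)); apply: ler_wpM2r.
  by rewrite invr_ge0 ltW// oneDsqr_gt0.
rewrite ler_wpM2l// lef_pV2 ?posrE ?oneDsqr_gt0// lerD2l.
move: us; rewrite inE/= in_itv/= andbT => us.
by rewrite lerXn2r ?nnegrE// ltW.
Qed.

End tail_integral.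

(** * Integration over planes *)

Section plane_integral.
Context {R : realType}.
Notation mu := (@lebesgue_measure R).
Notation halfline := (`[0%R, +oo[%classic : set R).
Implicit Types (N p s t u x y : R).

Variables (phi : R -> R) (N : R).
Hypothesis phi_cont : continuous phi.
Hypothesis phi_ge0 : forall u, 0 <= phi u.
Hypothesis phi_decay : decaying N phi.

Lemma integral_scale (G : R -> R) c : 0 < c -> continuous G ->
  (forall z, 0 <= G z) ->
  (\int[mu]_z (G z)%:E = \int[mu]_t (c * G (c * t))%:E)%E.
Proof.
move=> c0 cG G0; pose F t := c * t.
have dF t : is_derive t 1 F c by exact: is_derive_linl.
have F' : derive1 F = cst c.
  by apply/funext => t; rewrite derive1E; exact: derive_val.
rewrite (increasing_ge0_integration_by_substitutionT (F := F))//.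
- by apply: eq_integral => t _; rewrite F' /F; congr EFin; exact: mulrC.
- by move=> x y xy; rewrite /F ltr_pM2l.
- by rewrite F'; exact: cst_continuous.
- by rewrite F'; exact: is_cvg_cst.
- by rewrite F'; exact: is_cvg_cst.
- by apply: gt0_cvgMrNy => //; exact: cvg_id.
- by apply: gt0_cvgMry => //; exact: cvg_id.
Qed.

Let cont_radius (a c : R) : continuous (fun y => Num.sqrt (a + c * y ^+ 2)).
Proof.
move=> y; apply: (@continuous_comp _ _ _ (fun y => a + c * y ^+ 2) Num.sqrt).
  by apply: cvgD; [exact: cvg_cst|apply: cvgM; [exact: cvg_cst|exact: exprn_continuous]].
exact: sqrt_continuous.
Qed.

Let cont_phi_radius (a c : R) : continuous (fun y => phi (Num.sqrt (a + c * y ^+ 2))).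
Proof.
move=> y; apply: (@continuous_comp _ _ _ (fun y => Num.sqrt (a + c * y ^+ 2)) phi).
  exact: cont_radius.
exact: phi_cont.
Qed.

Let F := tail_integral phi.

(** With r^2 = u^2 + c y^2 one has r r' = c y, so - F(r) / c is a primitive. The condition c >= 1
    gives y <= r, hence its decay. *)
Lemma integral_radius_scaled u c : 1 <= c ->
  (\int[mu]_y (`|y| * phi (Num.sqrt (u ^+ 2 + c * y ^+ 2)))%:E =
   (2 * F `|u| / c)%:E)%E.
Proof.
move=> c1; have c0 : 0 < c by exact: lt_le_trans c1.
have cF : continuous F by exact: continuous_tail phi_decay.
rewrite integralT_even; last 3 first.
- by move=> y; rewrite mulr_ge0.
- by move=> y; apply: cvgM; [exact: norm_continuous|exact: cont_phi_radius].
- by move=> y; rewrite normrN sqrrN.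
pose r y := Num.sqrt (u ^+ 2 + c * y ^+ 2).
pose H y := - (c^-1 * F (r y)).
have yr y : 0 <= y -> y <= r y.
  move=> y0; rewrite /r -[leLHS](ger0_norm y0) -sqrtr_sqr ler_sqrt.
    by have := sqr_ge0 u; have := sqr_ge0 y; nra.
  by rewrite addr_ge0 ?sqr_ge0// mulr_ge0 ?sqr_ge0// ltW.
(* For u = 0 the radius has a corner at y = 0; the derivative is needed only for y > 0, together
   with continuity at 0. *)
have dH y : 0 < y -> is_derive y 1 H (y * phi (r y)).
  move=> y0; have r0 : 0 < r y by exact: lt_le_trans (yr _ (ltW y0)).
  have a0 : 0 < u ^+ 2 + c * y ^+ 2 by rewrite -sqrtr_gt0.
  have d1 : is_derive y 1 (fun y => u ^+ 2 + c * y ^+ 2) (2 * c * y).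
    under eq_fun do rewrite expr2.
    apply: (is_derive_eq (is_derive_add (is_derive_cst _ y 1) (is_derive_mull c
      (is_derive_mul (is_derive_id y 1) (is_derive_id y 1))))).
    by ring.
  have d2 := is_derive_comp (g := fun y => u ^+ 2 + c * y ^+ 2)
    (is_derive1_sqrt a0) d1.
  have d3 := is_derive_comp (g := r)
    (is_derive_tail phi_cont phi_decay (r y)) d2.
  apply: (is_derive_eq (is_derive_opp (is_derive_mull c^-1 d3))).
  by rewrite -/(r y); field; rewrite !gt_eqF.
have cH : continuous H.
  move=> y; apply: cvgN; apply: cvgM; first exact: cvg_cst.
  by apply: (@continuous_comp _ _ _ r F); [exact: cont_radius|exact: cF].
have -> : (\int[mu]_(y in halfline) (`|y| * phi (r y))%:E =
    \int[mu]_(y in halfline) (y * phi (r y))%:E)%E.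
  apply: eq_integral => y; rewrite inE/= in_itv/= andbT => y0.
  by rewrite ger0_norm.
rewrite (@ge0_continuous_FTC2y _ _ H 0 0).
- rewrite /H /r expr0n/= mulr0 addr0 sqrtr_sqr -EFinB -EFinM.
  by congr EFin; field; rewrite gt_eqF.
- by move=> y y0; rewrite mulr_ge0.
- apply: continuous_subspaceT => y.
  by apply: cvgM; [exact: cvg_id|exact: cont_phi_radius].
- apply: (cvg0_dominated (M := c^-1 * (N * (pi / 2)))) => y y0.
  rewrite /H normrN normrM ger0_norm ?invr_ge0 ?(ltW c0)// -mulrA.
  rewrite ler_wpM2l ?invr_ge0 ?(ltW c0)//.
  have ry0 : 0 <= r y by exact: sqrtr_ge0.
  have D := dominated_tail phi_cont phi_decay ry0.
  have M0 := dominated_ge0 (dominated_tail phi_cont phi_decay).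
  apply: (le_trans D); rewrite ler_wpM2l// lef_pV2 ?posrE ?oneDsqr_gt0// lerD2l.
  by rewrite lerXn2r ?nnegrE// yr.
- by move=> y y0; apply: ex_derive; exact: dH.
- by apply: cvg_at_right_filter; exact: cH.
- move=> y; rewrite in_itv/= andbT => y0; rewrite derive1E.
  by have := dH _ y0 => dHy; exact: derive_val.
Qed.

(** The substitution z = |y| t replaces polar coordinates: u^2 + y^2 + z^2 becomes u^2 + (1 + t^2)
    y^2. After exchanging the integrals, the one in y is explicit and leaves 1 / (1 + t^2), of
    integral pi. *)
Lemma plane_integral u :
  (\int[mu]_y \int[mu]_z (phi (Num.sqrt (u ^+ 2 + y ^+ 2 + z ^+ 2)))%:E =
   (2 * pi * F `|u|)%:E)%E.
Proof.
have E y : y != 0 ->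
    (\int[mu]_z (phi (Num.sqrt (u ^+ 2 + y ^+ 2 + z ^+ 2)))%:E =
     \int[mu]_t (`|y| * phi (Num.sqrt (u ^+ 2 + oneDsqr t * y ^+ 2)))%:E)%E.
  move=> y0.
  rewrite (@integral_scale (fun z => phi (Num.sqrt (u ^+ 2 + y ^+ 2 + z ^+ 2))) `|y|)//.
  - apply: eq_integral => t _; congr (_ * phi (Num.sqrt _))%:E.
    by rewrite exprMn real_normK ?num_real// /oneDsqr; ring.
  - by rewrite normr_gt0.
  - by have := @cont_phi_radius (u ^+ 2 + y ^+ 2) 1; under eq_fun do rewrite mul1r.
have mG : measurable_fun setT (fun q : R * R =>
    (`|q.1| * phi (Num.sqrt (u ^+ 2 + oneDsqr q.2 * q.1 ^+ 2)))%:E).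
  apply/measurable_EFinP; apply: measurable_funM.
    exact: measurableT_comp.
  apply: measurableT_comp; first exact: measurable_continuous.
  apply: measurableT_comp; first by apply: measurable_continuous; exact: sqrt_continuous.
  apply: measurable_funD => //; apply: measurable_funM.
    by apply: measurable_funD => //; exact: measurable_funX.
  exact: measurable_funX.
have mL : measurable_fun setT (fun q : R * R =>
    (phi (Num.sqrt (u ^+ 2 + q.1 ^+ 2 + q.2 ^+ 2)))%:E).
  apply/measurable_EFinP; apply: measurableT_comp; first exact: measurable_continuous.
  apply: measurableT_comp; first by apply: measurable_continuous; exact: sqrt_continuous.
  by apply: measurable_funD; [apply: measurable_funD => //|];
    exact: measurable_funX.
transitivity (\int[mu]_y \int[mu]_t
    (`|y| * phi (Num.sqrt (u ^+ 2 + oneDsqr t * y ^+ 2)))%:E)%E.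
  (* The substitution fails only for y = 0, a null set. *)
  apply: ge0_ae_eq_integral => //.
  - apply: (@measurable_fun_fubini_tonelli_F _ _ _ _ R mu _ mL) => q.
    by rewrite lee_fin.
  - apply: (@measurable_fun_fubini_tonelli_F _ _ _ _ R mu _ mG) => q.
    by rewrite lee_fin mulr_ge0.
  - by move=> y _; apply: integral_ge0 => z _; rewrite lee_fin.
  - by move=> y _; apply: integral_ge0 => z _; rewrite lee_fin mulr_ge0.
  exists [set 0]; split => //; first exact: lebesgue_measure_set1.
  move=> y /= H; apply/eqP; apply: contra_notT H => y0 _; exact: E.
transitivity (\int[mu]_t \int[mu]_y
    (`|y| * phi (Num.sqrt (u ^+ 2 + oneDsqr t * y ^+ 2)))%:E)%E.
  apply: (@fubini_tonelli _ _ _ _ R mu mu _ mG) => q.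
  by rewrite lee_fin mulr_ge0.
under eq_integral => t _ do rewrite integral_radius_scaled ?oneDsqr_ge1// EFinM.
rewrite ge0_integralZl_EFin//.
- by rewrite integralT_oneDsqrV -EFinM; congr EFin; ring.
- by apply/measurable_EFinP; exact: measurable_oneDsqrV.
- by rewrite mulr_ge0// tail_ge0.
Qed.

End plane_integral.

(** * Integration over space *)

(* An alias is needed: on [m1 \x m2] itself the library's sigma-finite structure
   is shadowed by the one for products of subprobabilities. *)
Section sigma_finite_product.
Context (R : realType) (d1 d2 : measure_display)
    (T1 : measurableType d1) (T2 : measurableType d2)
    (m1 : {sigma_finite_measure set T1 -> \bar R})
    (m2 : {sigma_finite_measure set T2 -> \bar R}).
Definition sigma_finite_product : set (T1 * T2) -> \bar R := (m1 \x m2)%E.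
HB.instance Definition _ := Measure.on sigma_finite_product.
HB.instance Definition _ := Measure_isSigmaFinite.Build _ _ _ sigma_finite_product
  (lebesgue_integral_fubini.product_measure_sigma_finite_subproof m1 m2).
End sigma_finite_product.

Lemma tonelli3 (R : realType) (d1 d2 d3 : measure_display)
    (T1 : measurableType d1) (T2 : measurableType d2) (T3 : measurableType d3)
    (m1 : {sigma_finite_measure set T1 -> \bar R})
    (m2 : {sigma_finite_measure set T2 -> \bar R})
    (m3 : {sigma_finite_measure set T3 -> \bar R})
    (f : T1 * T2 * T3 -> \bar R) :
  measurable_fun setT f -> (forall x, 0 <= f x)%E ->
  (\int[m1 \x m2 \x m3]_x f x =
   \int[m1]_x \int[m2]_y \int[m3]_z f (x, y, z))%E.
Proof.
move=> mf f0.
have E1 := @fubini_tonelli1 _ _ _ _ R (sigma_finite_product m1 m2) m3 f mf f0.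
have mF := @measurable_fun_fubini_tonelli_F _ _ _ _ R m3 f mf f0.
have F0 q : (0 <= fubini_F m3 f q)%E by apply: integral_ge0.
have E2 := @fubini_tonelli1 _ _ _ _ R m1 m2 _ mF F0.
exact: etrans E1 E2.
Qed.

Section space_integral.
Context {R : realType}.
Notation mu := (@lebesgue_measure R).
Notation halfline := (`[0%R, +oo[%classic : set R).
Implicit Types (N p s t u y z : R) (x : R * R * R).

Lemma ge0_integralT_split (k : R -> R) : (forall u, 0 <= k u) -> continuous k ->
  (\int[mu]_u (k u)%:E = \int[mu]_(u in halfline) (k u)%:E +
    \int[mu]_(u in halfline) (k (- u))%:E)%E.
Proof.
move=> k0 ck.
have mk : measurable_fun setT k by exact: continuous_measurable_fun.
rewrite -(setUv halfline) ge0_integral_setU//=; last 4 first.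
- exact: measurableC.
- by apply/measurable_EFinP; rewrite setUv.
- by move=> u _; rewrite lee_fin.
- exact/disj_setPCl.
congr (_ + _)%E.
rewrite setCitvr integral_itv_bndo_bndc; last first.
  by apply/measurable_EFinP; exact: measurable_funTS.
rewrite -{1}oppr0 ge0_integration_by_substitutionNy//.
exact: continuous_subspaceT.
Qed.

(** Adding the even majorant w makes k nonnegative; its contributions to the two sides are equal and
    cancel. *)
Lemma Rintegral_split N (k : R -> R) : continuous k ->
  (forall u, `|k u| <= N / oneDsqr u) ->
  \int[mu]_u k u = \int[mu]_(u in halfline) k u +
    \int[mu]_(u in halfline) k (- u).
Proof.
move=> ck kN.
have lin (a b c d : R) : a + (d + d) = b + d + (c + d) -> a = b + c by lra.
pose w u := N * (oneDsqr u)^-1.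
have cw : continuous w.
  by move=> u; apply: cvgM; [exact: cvg_cst|exact: continuous_oneDsqrV].
have wN u : w (- u) = w u by rewrite /w /oneDsqr sqrrN.
have w0 u : 0 <= w u by exact: le_trans (kN u).
have iw : mu.-integrable setT (EFin \o w).
  apply: (integrableT_dominated (N := N)); first exact: measurable_continuous.
  by move=> u; rewrite ger0_norm.
have ik : mu.-integrable setT (EFin \o k).
  by apply: (integrableT_dominated (N := N)) => //; exact: measurable_continuous.
have cNk : continuous (fun u => k (- u)).
  move=> u; apply: (@continuous_comp _ _ _ -%R k); last exact: ck.
  by apply: cvgN; exact: cvg_id.
have iNk : mu.-integrable setT (EFin \o (fun u => k (- u))).
  apply: (integrableT_dominated (N := N)); first exact: measurable_continuous.
  by move=> u; have := kN (- u); rewrite /oneDsqr sqrrN.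
have sub (h : R -> R) : mu.-integrable setT (EFin \o h) ->
    mu.-integrable halfline (EFin \o h) by exact: integrableS.
have E : \int[mu]_u (k u + w u) = \int[mu]_(u in halfline) (k u + w u) +
    \int[mu]_(u in halfline) (k (- u) + w u).
  rewrite /Rintegral ge0_integralT_split.
  - rewrite fineD; first by congr (_ + fine _); apply: eq_integral => u _; rewrite wN.
      by apply: integrable_fin_num => //; exact: (integrableD _ (sub _ ik) (sub _ iw)).
    under eq_integral do rewrite wN.
    by apply: integrable_fin_num => //; exact: (integrableD _ (sub _ iNk) (sub _ iw)).
  - by move=> u; have := kN u; rewrite ler_norml -/(w u) => /andP[]; lra.
  - exact: continuous_add.
have W : \int[mu]_u w u = \int[mu]_(u in halfline) w u + \int[mu]_(u in halfline) w u.
  rewrite /Rintegral ge0_integralT_split//.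
  under [X in (_ + X)%E]eq_integral do rewrite wN.
  by rewrite fineD//; apply: integrable_fin_num => //; exact: sub.
by move: E; rewrite !RintegralD//; [rewrite W => /lin|exact: sub..].
Qed.

Variables (phi : R -> R) (N : R).
Hypothesis phi_cont : continuous phi.
Hypothesis phi_ge0 : forall u, 0 <= phi u.
Hypothesis phi_decay : decaying N phi.

Definition radius3 x := Num.sqrt (x.1.1 ^+ 2 + x.1.2 ^+ 2 + x.2 ^+ 2).

Lemma measurable_phi_radius3 : measurable_fun setT (fun x => phi (radius3 x)).
Proof.
apply: measurableT_comp; first exact: measurable_continuous.
apply: measurableT_comp; first by apply: measurable_continuous; exact: sqrt_continuous.
apply: measurable_funD; [apply: measurable_funD|]; apply: measurable_funX => //.
- exact: (measurableT_comp measurable_fst measurable_fst).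
- exact: (measurableT_comp measurable_snd measurable_fst).
Qed.

Let G u := 2 * pi * tail_integral phi `|u|.

Let G_le u : `|G u| <= (2 * pi * (N * (pi / 2))) / oneDsqr u.
Proof.
rewrite /G normrM ger0_norm ?mulr_ge0 ?pi_ge0// -mulrA ler_wpM2l ?mulr_ge0 ?pi_ge0//.
have := dominated_tail phi_cont phi_decay (normr_ge0 u).
by rewrite /oneDsqr real_normK// num_real.
Qed.

Let cG : continuous G.
Proof.
move=> u; apply: cvgM; first exact: cvg_cst.
apply: (@continuous_comp _ _ _ (fun u : R => `|u|) (tail_integral phi)).
  exact: norm_continuous.
exact: continuous_tail phi_decay _.
Qed.

Lemma ge0_space_integral (h : R -> R) : measurable_fun setT h ->
  (forall u, 0 <= h u) ->
  (\int[lebesgue3]_x (h x.1.1 * phi (radius3 x))%:E = \int[mu]_u (h u * G u)%:E)%E.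
Proof.
move=> mh h0.
have mF : measurable_fun setT (fun x => (h x.1.1 * phi (radius3 x))%:E).
  apply/measurable_EFinP; apply: measurable_funM.
    apply: (measurableT_comp mh).
    exact: (measurableT_comp measurable_fst measurable_fst).
  exact: measurable_phi_radius3.
have F0 x : (0 <= (h x.1.1 * phi (radius3 x))%:E)%E by rewrite lee_fin mulr_ge0.
transitivity (\int[mu]_u \int[mu]_y \int[mu]_z
    (h u * phi (radius3 (u, y, z)))%:E)%E.
  have Q := @tonelli3 R _ _ _ _ _ _ mu mu mu _ mF F0. exact: Q.
apply: eq_integral => u _.
transitivity (\int[mu]_y ((h u)%:E *
    \int[mu]_z (phi (Num.sqrt (u ^+ 2 + y ^+ 2 + z ^+ 2)))%:E))%E.
  apply: eq_integral => y _.
  rewrite -ge0_integralZl_EFin//.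
    by move=> z _; rewrite lee_fin.
  apply/measurable_EFinP; apply: measurableT_comp; first exact: measurable_continuous.
  apply: measurableT_comp; first by apply: measurable_continuous; exact: sqrt_continuous.
  by apply: measurable_funD => //; exact: measurable_funX.
rewrite ge0_integralZl_EFin//.
- by rewrite (plane_integral phi_cont phi_ge0 phi_decay) -EFinM.
- by move=> y _; apply: integral_ge0 => z _; rewrite lee_fin.
have mP : measurable_fun setT (fun q : R * R =>
    (phi (Num.sqrt (u ^+ 2 + q.1 ^+ 2 + q.2 ^+ 2)))%:E).
  apply/measurable_EFinP; apply: measurableT_comp; first exact: measurable_continuous.
  apply: measurableT_comp; first by apply: measurable_continuous; exact: sqrt_continuous.
  by apply: measurable_funD; [apply: measurable_funD => //|];
    exact: measurable_funX.
apply: (@measurable_fun_fubini_tonelli_F _ _ _ _ R mu _ mP) => q.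
by rewrite lee_fin.
Qed.

Lemma integrable_mul_radius3 (h : R -> R) :
  continuous h -> (forall u, `|h u| <= 1) ->
  lebesgue3.-integrable setT (EFin \o (fun x => phi (radius3 x))) ->
  lebesgue3.-integrable setT (EFin \o (fun x => h x.1.1 * phi (radius3 x))).
Proof.
move=> ch h1 iphi.
have mh3 : measurable_fun setT (fun x => h x.1.1).
  apply: (@measurableT_comp _ _ _ _ _ _ h); first exact: measurable_continuous.
  exact: (measurableT_comp measurable_fst measurable_fst).
apply: (le_integrable _ _ _ iphi) => //.
  by apply/measurable_EFinP; apply: measurable_funM => //; exact: measurable_phi_radius3.
by move=> x _; rewrite /= lee_fin normrM ler_piMl.
Qed.

(** Since |h| <= 1, the nonnegative case applies to h + 1 and to 1; subtraction gives the signed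
    case. *)
Lemma space_integral (h : R -> R) : continuous h -> (forall u, `|h u| <= 1) ->
  lebesgue3.-integrable setT (EFin \o (fun x => phi (radius3 x))) ->
  \int[lebesgue3]_x (h x.1.1 * phi (radius3 x)) = \int[mu]_u (h u * G u).
Proof.
move=> ch h1 iphi.
have mh : measurable_fun setT h by exact: measurable_continuous.
have ihphi := integrable_mul_radius3 ch h1 iphi.
have iG : mu.-integrable setT (EFin \o G).
  by apply: integrableT_dominated G_le; exact: measurable_continuous.
have ihG : mu.-integrable setT (EFin \o (fun u => h u * G u)).
  apply: (integrableT_dominated (N := 2 * pi * (N * (pi / 2)))).
    by apply: measurable_continuous; exact: continuous_mul.
  by move=> u; rewrite normrM (le_trans _ (G_le u))// ler_piMl.
have E1 : \int[lebesgue3]_x (h x.1.1 * phi (radius3 x) + phi (radius3 x)) =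
    \int[mu]_u (h u * G u + G u).
  apply: (congr1 fine).
  under eq_integral do rewrite -[X in (_ + X)]mul1r -mulrDl.
  under [RHS]eq_integral do rewrite -[X in (_ + X)]mul1r -mulrDl.
  rewrite (@ge0_space_integral (fun u => h u + 1))//; first exact: measurable_funD.
  by move=> u; have := h1 u; rewrite ler_norml => /andP[]; lra.
have E0 : \int[lebesgue3]_x phi (radius3 x) = \int[mu]_u G u.
  apply: (congr1 fine).
  under eq_integral do rewrite -[phi _]mul1r.
  under [RHS]eq_integral do rewrite -[G _]mul1r.
  by rewrite (@ge0_space_integral (fun=> 1)).
move: E1; rewrite RintegralD// RintegralD// E0.
exact: addIr.
Qed.

Hypothesis phi_integrable : lebesgue3.-integrable setT (EFin \o (fun x => phi (radius3 x))).

Let hG_split (h : R -> R) : continuous h -> (forall u, `|h u| <= 1) ->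
  \int[lebesgue3]_x (h x.1.1 * phi (radius3 x)) =
  \int[mu]_(u in halfline) (h u * G u) + \int[mu]_(u in halfline) (h (- u) * G u).
Proof.
move=> ch h1; rewrite space_integral//.
have -> : (fun u => h (- u) * G u) = (fun u => h (- u) * G (- u)).
  by apply/funext => u; rewrite /G normrN.
apply: (@Rintegral_split (2 * pi * (N * (pi / 2))) (fun u => h u * G u)).
- exact: continuous_mul.
- by move=> u; rewrite normrM (le_trans _ (G_le u))// ler_piMl.
Qed.

Lemma space_integral_sin p :
  \int[lebesgue3]_x (sin (p * x.1.1) * phi (radius3 x)) = 0.
Proof.
rewrite (@hG_split (fun u => sin (p * u))).
- under [X in _ + X]eq_Rintegral do rewrite mulrN sinN mulNr -mulN1r.
  rewrite RintegralZl//; first by rewrite mulN1r subrr.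
  apply: (@integrable_dominated _ (2 * pi * (N * (pi / 2)))).
    apply: measurable_continuous; apply: continuous_mul => //.
    exact: continuous_sin_lin.
  by apply: dominated_sin => u _; exact: G_le.
- exact: continuous_sin_lin.
- by move=> u; exact: abs_sin_le1.
Qed.

(** The marginal is 2 pi F(|u|) with F' = - u phi(u). One integration by parts, without boundary
    term, turns p times its cosine transform into a sine transform; the two half-lines double 2 pi
    into 4 pi. *)
Lemma space_integral_cos p :
  p * \int[lebesgue3]_x (cos (p * x.1.1) * phi (radius3 x)) =
  sinT (fun u => 4 * pi * (u * phi u)) p.
Proof.
pose F := tail_integral phi.
have dF u : is_derive u 1 F (- (u * phi u)) by exact: is_derive_tail phi_decay u.
have cphi : continuous (fun u => u * phi u).
  by apply: continuous_mul => // u; exact: cvg_id.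
have FM := dominated_tail phi_cont phi_decay.
have pM : dominated N (fun u => u * phi u).
  by have := decaying_dominated (leqnSn 1) phi_decay; under eq_fun do rewrite expr1.
have M0 := dominated_ge0 FM; have N0 := dominated_ge0 pM.
rewrite (@hG_split (fun u => cos (p * u))); last 2 first.
- exact: continuous_cos_lin.
- by move=> u; exact: abs_cos_le1.
under [X in _ + X]eq_Rintegral do rewrite mulrN cosN.
have -> : \int[mu]_(u in halfline) (cos (p * u) * G u) =
    cosT (fun u => 2 * pi * F u) p.
  apply: eq_Rintegral => u; rewrite inE/= in_itv/= andbT => u0.
  by rewrite /G ger0_norm.
have cF := is_derive_continuous dF.
rewrite (cosTZ (2 * pi) p cF FM) (sinTZ (4 * pi) p cphi pM).
have := @cosT_derive R (N * (pi / 2) + N) F (fun u => - (u * phi u)) p dF.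
have -> : sinT (fun u => - (u * phi u)) p = - sinT (fun u => u * phi u) p.
  rewrite -mulN1r -(sinTZ (- 1) p cphi pM).
  by apply: eq_Rintegral => u _; rewrite mulN1r.
rewrite opprK.
move=> <-; first by ring.
- by move=> u; apply: cvgN; exact: cphi.
- by apply: dominated_le FM; rewrite lerDl.
- by move=> u u0; rewrite normrN; apply: dominated_le pM _ u0; rewrite lerDr.
Qed.

End space_integral.

(** * Fourier transform of a radial function and the function a *)

Section radial_profile.
Context {R : realType}.
Implicit Types (mu : 'rV[R]_3 -> R) (p u y : R).

(** Iterated derivatives along one axis, with u of either sign: for radial mu and k = 0 this is the
    even extension of the radial profile, for larger k its successive derivatives. *)
Definition profile mu k u := partials (nseq k 0) mu (u *: basis3 0).

Lemma dot3_scale_basis (v : 'rV[R]_3) u : dot3 v (u *: basis3 0) = v 0 0 * u.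
Proof.
rewrite /dot3 !big_ord_recl big_ord0 !mxE/= mulr1 !mulr0 !addr0.
by congr (v 0 _ * _); apply/val_inj.
Qed.

Lemma norm3_scale_basis u : norm3 (u *: @basis3 R 0) = `|u|.
Proof.
by rewrite /norm3 dot3_scale_basis !mxE/= mulr1 -expr2 sqrtr_sqr.
Qed.

Lemma norm3_vec3 (x : R * R * R) : norm3 (vec3 x) = radius3 x.
Proof.
rewrite /norm3 /radius3; congr Num.sqrt.
by rewrite /dot3 !big_ord_recl big_ord0 !mxE/= addr0 !expr2 addrA.
Qed.

Lemma radius3_ge0 (x : R * R * R) : 0 <= radius3 x.
Proof. exact: sqrtr_ge0. Qed.

Lemma radial_vec3 mu (x : R * R * R) : radial mu ->
  mu (vec3 x) = profile mu 0 (radius3 x).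
Proof.
move=> rmu; apply: rmu.
by rewrite norm3_vec3 norm3_scale_basis ger0_norm// radius3_ge0.
Qed.

Lemma is_derive_profile mu k u : smooth3 mu ->
  is_derive u 1 (profile mu k) (profile mu k.+1 u).
Proof.
move=> smu; have [_ /(_ 0 (u *: basis3 0)) d] := smu (nseq k 0).
have E : (fun h : R => h^-1 *: ((profile mu k \o shift u) (h *: 1) - profile mu k u)) =
    (fun h => h^-1 *: ((partials (nseq k 0) mu \o shift (u *: basis3 0))
      (h *: basis3 0) - partials (nseq k 0) mu (u *: basis3 0))).
  by apply/funext => h; rewrite /profile/= [h *: 1]mulr1 scalerDl.
apply: DeriveDef.
  by rewrite /derivable E.
by rewrite /derive E.
Qed.

Lemma profile_le_norm_grad mu k u :
  `|profile mu k u| <= norm_grad k mu (u *: basis3 0).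
Proof.
rewrite /norm_grad -sqrtr_sqr ler_sqrt; last by apply: sumr_ge0 => s _; exact: sqr_ge0.
rewrite (bigD1 [tuple of nseq k 0])//= lerDl.
by apply: sumr_ge0 => s _; exact: sqr_ge0.
Qed.

Lemma profile1_0 mu : smooth3 mu -> radial mu -> profile mu 1 0 = 0.
Proof.
move=> smu rmu; have d := is_derive_profile 0 0 smu.
have d' : is_derive (- 0 : R) 1 (profile mu 0) (profile mu 1 0) by rewrite oppr0.
have H := is_derive_comp (g := fun u : R => - u) d' (is_derive_opp (is_derive_id (0 : R) 1)).
have even : (fun u => profile mu 0 (- u)) = profile mu 0.
  apply/funext => u; apply: rmu.
  by rewrite !norm3_scale_basis normrN.
rewrite even in H.
have := @derive_val _ _ _ _ _ _ _ H; rewrite (@derive_val _ _ _ _ _ _ _ d); lra.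
Qed.

(** The only place where C and c are turned into a constant: all later bounds depend on them through
    N. *)
Lemma exp_decaying (C c : nat -> R) :
  (forall k, 0 < C k) -> (forall k, 0 < c k) ->
  exists N, forall k, (k <= 3)%N -> forall u,
    C k * expR (- (c k * `|u|)) <= N / oneDsqr u ^+ 3.
Proof.
move=> C0 c0.
have H k : exists N, 0 <= N /\ forall u, C k * expR (- (c k * `|u|)) <= N / oneDsqr u ^+ 3.
  have [N N0 HN] := oneDsqr_le_expR 3 (c0 k).
  exists (C k * N); split; first by rewrite mulr_ge0// ltW.
  move=> u; rewrite -mulrA ler_wpM2l ?(ltW (C0 k))// ler_pdivlMr ?exprn_gt0 ?oneDsqr_gt0//.
  by rewrite expRN mulrC ler_pdivrMr ?expR_gt0.
have [N0 [N00 H0]] := H 0%N; have [N1 [N10 H1]] := H 1%N.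
have [N2 [N20 H2]] := H 2%N; have [N3 [N30 H3]] := H 3%N.
exists (N0 + N1 + N2 + N3) => k k3 u.
have o0 : 0 <= (oneDsqr u ^+ 3)^-1 by rewrite invr_ge0 exprn_ge0// ltW// oneDsqr_gt0.
move: k k3 => [|[|[|[|//]]]] _.
- by apply: (le_trans (H0 u)); apply: ler_wpM2r => //; lra.
- by apply: (le_trans (H1 u)); apply: ler_wpM2r => //; lra.
- by apply: (le_trans (H2 u)); apply: ler_wpM2r => //; lra.
- by apply: (le_trans (H3 u)); apply: ler_wpM2r => //; lra.
Qed.

End radial_profile.

(** * The function a as a Laplace transform *)

Section fourier_penrose.
Context {R : realType}.
Implicit Types (p u y : R).
Variables (mu : 'rV[R]_3 -> R) (N : R).
Hypothesis mu_smooth : smooth3 mu.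
Hypothesis mu_radial : radial mu.
Hypothesis mu_density : probability_density3 mu.
Hypothesis mu_decay : forall k, (k <= 3)%N -> decaying N (profile mu k).

Let phi := profile mu 0.
Let phi_derive k u : is_derive u 1 (profile mu k) (profile mu k.+1 u).
Proof. exact: is_derive_profile. Qed.

Let phi_cont : continuous phi.
Proof. exact: is_derive_continuous (phi_derive 0). Qed.

Let phi_ge0 u : 0 <= phi u.
Proof. by case: mu_density => + _; apply. Qed.

Let phi_decay : decaying N phi. Proof. exact: mu_decay. Qed.

Let g := sinT (radial_density (profile mu)).

Let phi_integrable :
  lebesgue3.-integrable setT (EFin \o (fun x : R * R * R => phi (radius3 x))).
Proof.
apply/integrableP; split.
  by apply/measurable_EFinP; exact: measurable_phi_radius3.
have [_ m1] := mu_density.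
rewrite (_ : (\int[lebesgue3]_x _ = 1)%E) ?ltry// -m1.
by apply: eq_integral => x _; rewrite /= radial_vec3// ger0_norm.
Qed.

Local Open Scope complex_scope.

Lemma cexp_mulNi (a : R) : cexp (- ('i%C * a%:C)) = (cos a) +i* (- sin a).
Proof.
have -> : - ('i%C * a%:C) = 0 +i* (- a) by simpc.
by rewrite /cexp/= expR0 !mul1r cosN sinN.
Qed.

Lemma complexZ (r a b : R) : (r * a) +i* (r * b) = r%:C * (a +i* b).
Proof. by simpc. Qed.

(** The imaginary part vanishes by reflection in the first coordinate. Keeping the factor p avoids a
    division at p = 0. *)
Lemma fourier3_radial p : p%:C * fourier3 mu (p *: basis3 0) = (g p)%:C.
Proof.
have kE (x : R * R * R) : cexp (- ('i%C * (dot3 (vec3 x) (p *: basis3 0))%:C)) *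
    (mu (vec3 x))%:C =
    (cos (p * x.1.1) * phi (radius3 x)) +i* (-1 * (sin (p * x.1.1) * phi (radius3 x))).
  rewrite (radial_vec3 _ mu_radial) dot3_scale_basis mxE/= -/phi mulrC cexp_mulNi.
  rewrite (mulrC x.1.1) -complexZ; congr (_ +i* _); ring.
have isin : lebesgue3.-integrable setT
    (EFin \o (fun x : R * R * R => sin (p * x.1.1) * phi (radius3 x))).
  apply: (@integrable_mul_radius3 _ phi phi_cont (fun u => sin (p * u))) => //.
    exact: continuous_sin_lin.
  by move=> u; exact: abs_sin_le1.
rewrite /fourier3 /Cintegral.
under eq_Rintegral do rewrite kE/=.
under [X in _ +i* X]eq_Rintegral do rewrite kE/=.
rewrite RintegralZl// (space_integral_sin phi_cont phi_ge0 phi_decay)//.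
rewrite mulr0 -complexZ mulr0.
by rewrite (space_integral_cos phi_cont phi_ge0 phi_decay).
Qed.

Lemma penrose_aE (z : R[i]) : complex.Im z <= 0 ->
  penrose_a mu z = (- lapC g (complex.Re z) (- complex.Im z)) +i*
    (lapS g (complex.Re z) (- complex.Im z)).
Proof.
move=> z0; set x := complex.Re z; set y := - complex.Im z.
have y0 : 0 <= y by rewrite oppr_ge0.
have kE p : cexp (- ('i%C * p%:C * z)) * p%:C * fourier3 mu (p *: basis3 0) =
    (expR (- (p * y)) * cos (p * x) * g p) +i*
    (-1 * (expR (- (p * y)) * sin (p * x) * g p)).
  rewrite -mulrA fourier3_radial mulrC.
  have -> : - ('i%C * p%:C * z) = (- (p * y)) +i* (- (p * x)).
    by rewrite /x /y; case: z {z0 x y y0} => a b; simpc.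
  by rewrite /cexp/= cosN sinN -complexZ; congr (_ +i* _); ring.
have [cb bM [dg _ gK _ _]] :=
  radial_density_transform phi_derive mu_decay (profile1_0 mu_smooth mu_radial).
rewrite /penrose_a /Cintegral.
under eq_Rintegral do rewrite kE/=.
under [X in _ +i* X]eq_Rintegral do rewrite kE/=.
have iS := integrable_lapS x y0 (is_derive_continuous dg) gK.
rewrite (RintegralZl (-1) _ iS)// -/(lapC g x y) -/(lapS g x y).
by simpc.
Qed.

Lemma normc_penrose t (z : R[i]) : complex.Im z <= 0 ->
  Normc.normc (1 - t%:C * penrose_a mu z) =
  Num.sqrt ((1 + t * lapC g (complex.Re z) (- complex.Im z)) ^+ 2 +
            (t * lapS g (complex.Re z) (- complex.Im z)) ^+ 2).
Proof.
move=> z0; rewrite penrose_aE// -complexZ.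
set A := lapC _ _ _; set B := lapS _ _ _.
have -> : 1 - ((t * - A) +i* (t * B)) = (1 + t * A) +i* (- (t * B)).
  by simpc; congr (_ +i* _); ring.
by rewrite /Normc.normc/= sqrrN.
Qed.

End fourier_penrose.

(** Screening keeps the multiplier bounded as xi tends to 0, so t stays in a compact interval. *)
Lemma phi_hat_itv (R : realType) (xi : 'rV[R]_3) : 0 <= phi_hat xi <= 1.
Proof.
have h : 1 <= 1 + norm3 xi ^+ 2 by rewrite lerDl sqr_ge0.
rewrite /phi_hat invr_ge0 (le_trans ler01 h)/= invf_le1//.
exact: lt_le_trans h.
Qed.

Unset Implicit Arguments.

Theorem proposition1p5 (R : realType) (C c : nat -> R)
    (C_gt0 : forall k, 0 < C k) (c_gt0 : forall k, 0 < c k) :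
  exists2 Cbar : R, 0 < Cbar &
    forall mu : 'rV[R]_3 -> R,
      smooth3 mu -> radial mu -> probability_density3 mu ->
      (forall (k : nat) (v : 'rV[R]_3),
         norm_grad k mu v <= C k * expR (- (c k * norm3 v))) ->
      (forall v : 'rV[R]_3, norm3 v <= Cbar -> 0 < mu v) ->
      penrose_stable mu.
Proof.
have [N HN] := exp_decaying C_gt0 c_gt0.
(* The radius is fixed from N alone, before mu is introduced; this is the required uniformity. *)
have [r r0 H] := profile_lower_bound N.
exists r => // mu smu rmu dmu dec pos.
have decay k : (k <= 3)%N -> decaying N (profile mu k).
  move=> k3 u; apply: (le_trans (profile_le_norm_grad mu k u)).
  by apply: (le_trans (dec _ _)); rewrite norm3_scale_basis HN.
have [kappa kappa0 lb] : exists2 kappa : R, 0 < kappa &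
    forall x y t, 0 <= y -> 0 <= t <= 1 ->
    kappa <= (1 + t * lapC (sinT (radial_density (profile mu))) x y) ^+ 2 +
             (t * lapS (sinT (radial_density (profile mu))) x y) ^+ 2.
  apply: H.
  - by move=> k u; exact: is_derive_profile.
  - exact: decay.
  - exact: profile1_0.
  - by move=> u; case: dmu => + _; apply.
  - by move=> u /andP[u0 ur]; apply: pos; rewrite norm3_scale_basis ger0_norm.
(* The bound obtained so far concerns the squared modulus. *)
exists (Num.sqrt kappa); first by rewrite sqrtr_gt0.
apply: lb_le_inf.
  (* A lower bound passes to the infimum of a nonempty set; z = 0 and xi = 0 provide an element. *)
  by exists (Normc.normc (1 - (phi_hat (0 : 'rV[R]_3))%:C%C * penrose_a mu 0));
    exists 0 => //=; exists 0.
move=> _ [z z0] [xi _ <-]; rewrite /mkset in z0.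
rewrite (normc_penrose smu rmu dmu decay _ z0) ler_wsqrtr// lb ?oppr_ge0//.
exact: phi_hat_itv.
Qed.
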